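(* Let $M\ge 1$ be an integer, $N=3M-1$, $M_1=(N-2)/3$, $M_2=(N+1)/3$. For $0\le n\le M_1$ define the wave function $$\Psi_n[z_1,\dots,z_{M_1};w_1,\dots,w_{M_2}]=\frac1N\sum_{\gamma=1}^N(\bar\eta_\gamma)^n\prod_{i=1}^{M_1}(\eta_\gamma-z_i)\;\Psi_0[z_i;w_k],$$ and let $|\Psi_n\rangle$ be the corresponding state. Then for every $0\le n\le M_1$ the state $|\Psi_n\rangle$ is an exact eigenstate of the Hamiltonian, $$H_{\mathrm{SU(3)}}|\Psi_n\rangle=E_n|\Psi_n\rangle,$$ with $$E_n=-\frac{\pi^2}{18}\left(N+\frac1N+\frac2{N^2}\right)+\frac{3\pi^2}{N^2}(M_1-n)\,n=E_0+\frac29\frac{\pi^2}{N^2}+\epsilon(p),$$ where $E_0=-\frac{\pi^2}{18}\left(N+\frac7N\right)$, $\epsilon(p)=\frac34\left(\frac{\pi^2}{9}-(p-\pi)^2\right)$, and $$p=\frac{4\pi}{3}-\frac{2\pi}{N}\left(n+\frac13\right)$$ is the momentum of $|\Psi_n\rangle$. For $M_1<n<N$ the wave function $\Psi_n$ (defined by the same formula) vanishes identically. Moreover, for $0\le n\le M_1$, $|\Psi_n\rangle$ transforms under the total SU(3) spin according to the representation $\bar 3$ (conjugate to the fundamental representation $3$ carried by each site); it is the lowest weight state of this $\bar 3$, i.e. it is annihilated by $I^-=\sum_\alpha e_\alpha^{\mathrm{rb}}$, $V^-=\sum_\alpha e_\alpha^{\mathrm{gb}}$ and $U^-=\sum_\alpha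 e_\alpha^{\mathrm{gr}}$.
   Context: The Hilbert space is $(\mathbb C^3)^{\otimes N}$, each site $\alpha=1,\dots,N$ carrying the fundamental representation $3$ of SU(3) with orthonormal basis b (blue), r (red), g (green). The sites are identified with the $N$-th roots of unity $\eta_\alpha=\exp(2\pi i\alpha/N)$. The colorflip operator $e_\alpha^{\sigma\tau}$ is the matrix unit $|\sigma\rangle\langle\tau|$ acting on site $\alpha$ (turning color $\tau$ into color $\sigma$). The SU(3) Haldane--Shastry Hamiltonian is $$H_{\mathrm{SU(3)}}=\frac{2\pi^2}{N^2}\sum_{1\le\alpha<\beta\le N}\ \sum_{\sigma,\tau\in\{\mathrm b,\mathrm r,\mathrm g\}}\frac{e_\alpha^{\sigma\tau}e_\beta^{\tau\sigma}-\frac1{27}}{|\eta_\alpha-\eta_\beta|^2}.$$ SU(3) acts on $(\mathbb C^3)^{\otimes N}$ through the total spin, i.e. the Lie algebra action generated by the operators $\sum_\alpha e_\alpha^{\sigma\tau}$, $\sigma\neq\tau$ (and their commutators). A wave function $\Psi[z_1,\dots,z_{M_1};w_1,\dots,w_{M_2}]$, symmetric in the $z_i$ and symmetric in the $w_k$, represents the state $$|\Psi\rangle=\sum_{\{z_i,w_k\}}\Psi[z_i;w_k]\;e_{z_1}^{\mathrm{bg}}\cdots e_{z_{M_1}}^{\mathrm{bg}}e_{w_1}^{\mathrm{rg}}\cdots e_{w_{M_2}}^{\mathrm{rg}}|0_{\mathrm g}\rangle,$$ where $|0_{\mathrm g}\rangle$ is the state with every site green, and the sum is over all ways of placing the blue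 particles $\{z_i\}$ and red particles $\{w_k\}$ on pairwise distinct sites of the lattice $\{\eta_1,\dots,\eta_N\}$. Further, $$\Psi_0[z_i;w_k]=\prod_{i<j}^{M_1}(z_i-z_j)^2\prod_{k<l}^{M_2}(w_k-w_l)^2\prod_{i=1}^{M_1}\prod_{k=1}^{M_2}(z_i-w_k)\prod_{i=1}^{M_1}z_i\prod_{k=1}^{M_2}w_k .$$ The momentum $p$ (mod $2\pi$) of a state with wave function $\Psi$ is defined by $e^{ip}=\Psi[\eta_1z_i;\eta_1w_k]/\Psi[z_i;w_k]$ with $\eta_1=\exp(2\pi i/N)$ (all coordinates multiplied by $\eta_1$). *)

(* Defs.v *)
From HB Require Import structures.
From mathcomp Require Import all_boot all_order all_algebra.
From mathcomp Require Import complex.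
From mathcomp Require Import reals trigo.

Set Implicit Arguments.
Unset Strict Implicit.
Unset Printing Implicit Defensive.

Import Order.TTheory GRing.Theory Num.Theory.
Local Open Scope ring_scope.
Local Open Scope complex_scope.

(* Colors index the orthonormal basis (b, r, g) of C^3, so that 'M_3 acts on
   it. *)
Definition color := 'I_3.
Definition blue : color := @Ordinal 3 0 isT.
Definition red : color := @Ordinal 3 1 isT.
Definition green : color := @Ordinal 3 2 isT.

Notation config N := {ffun 'I_N -> color}.

(* (C^3)^{(x) N} in the product basis: a state is the family of its
   coefficients on the color configurations. *)
Notation state R N := {ffun config N -> (R[i])^o}.

(* eta N k = exp (2 pi i k / N) *)
Definition eta (R : realType) (N k : nat) : R[i] :=
  let t : R := 2 * pi * k%:R / N%:R in cos t +i* sin t.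

(* 'I_N starts at 0 whereas sites are labelled 1, ..., N. *)
Definition site (R : realType) (N : nat) (a : 'I_N) : R[i] := eta R N a.+1.

Definition recolor (N : nat) (c : config N) (a : 'I_N) (t : color) : config N :=
  [ffun b => if b == a then t else c b].

(* e_a^{s t} = |s><t| at site a; on coefficients,
   <c| e_a^{s t} |psi> = delta_{c a, s} <c with t at site a|psi>. *)
Definition flip (R : realType) (N : nat) (a : 'I_N) (s t : color)
    (psi : state R N) : state R N :=
  [ffun c : config N => if c a == s then psi (recolor c a t) else 0].

Definition hamiltonian (R : realType) (N : nat) (psi : state R N) : state R N :=
  (2 * pi ^+ 2 / N%:R ^+ 2)%:C *:
    \sum_(a < N) \sum_(b < N | (a < b)%N) \sum_(s : color) \sum_(t : color)
      (`|site R a - site R b| ^+ 2)^-1 *: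
        (flip a s t (flip b t s psi) - (27%:R^-1 : R[i]) *: psi).

Definition total_flip (R : realType) (N : nat) (s t : color)
    (psi : state R N) : state R N := \sum_(a < N) flip a s t psi.

Definition Iminus (R : realType) (N : nat) (psi : state R N) : state R N :=
  total_flip red blue psi.
Definition Vminus (R : realType) (N : nat) (psi : state R N) : state R N :=
  total_flip green blue psi.
Definition Uminus (R : realType) (N : nat) (psi : state R N) : state R N :=
  total_flip green red psi.

(* Total spin action of a matrix X, to be used for traceless X: this is the Lie
   algebra action of sl_3(C) = su(3) (x) C spanned by the total color flips with
   s != t and their commutators. *)
Definition total_spin (R : realType) (N : nat) (X : 'M[R[i]]_3)
    (psi : state R N) : state R N :=
  \sum_(s : color) \sum_(t : color) X s t *: total_flip s t psi.

(* The representation 3-bar of sl_3(C): the complex-linear extension of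
   X |-> (complex conjugate of X) on su(3), see conj_repE. *)
Definition conj_rep (R : realType) (X : 'M[R[i]]_3) : 'M[R[i]]_3 := - X^T.

Lemma conj_repE (R : realType) (X : 'M[R[i]]_3) :
  (map_mx Num.conj X)^T = - X -> conj_rep X = map_mx Num.conj X.
Proof.
by move=> XH; rewrite /conj_rep -(trmxK (map_mx _ X)) XH linearN.
Qed.

Definition spin_invariant (R : realType) (N : nat) (U : {vspace state R N}) :=
  forall (s t : color) (phi : state R N),
    s != t -> phi \in U -> total_flip s t phi \in U.

Definition spin_module_of (R : realType) (N : nat) (psi : state R N)
    (U : {vspace state R N}) :=
  [/\ spin_invariant U, psi \in U &
      forall W : {vspace state R N},
        spin_invariant W -> psi \in W -> (U <= W)%VS].

(* The spin module generated by psi is isomorphic to 3-bar. *)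
Definition transforms_as_3bar (R : realType) (N : nat) (psi : state R N) :=
  exists U : {vspace state R N}, spin_module_of psi U /\
  exists f : 'Hom('cV[R[i]]_3, state R N),
    [/\ lker f = 0%VS, limg f = U &
        forall (X : 'M[R[i]]_3) (v : 'cV[R[i]]_3),
          \tr X = 0 -> f (conj_rep X *m v) = total_spin X (f v)].

Definition eigenstate (R : realType) (N : nat)
    (A : state R N -> state R N) (E : R) (psi : state R N) :=
  psi != 0 /\ A psi = E%:C *: psi.

Definition wavefun (R : realType) (M1 M2 : nat) :=
  ('I_M1 -> R[i]) -> ('I_M2 -> R[i]) -> R[i].

Definition all_green (R : realType) (N : nat) : state R N :=
  [ffun c : config N => ((c == [ffun=> green])%:R : R[i])].

Definition placement (N M1 M2 : nat) (z : {ffun 'I_M1 -> 'I_N})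
    (w : {ffun 'I_M2 -> 'I_N}) : bool :=
  [&& injectiveb z, injectiveb w & [disjoint codom z & codom w]].

Definition increasing (N m : nat) (z : {ffun 'I_m -> 'I_N}) : bool :=
  [forall i : 'I_m, forall j : 'I_m, (i < j)%N ==> (z i < z j)%N].

(* Particles of one color are identical and wave functions are symmetric, so
   every choice of the sets {z_i} and {w_k} is counted once by listing the
   sites in increasing order. *)
Definition ket (R : realType) (N M1 M2 : nat) (Psi : wavefun R M1 M2) :
    state R N :=
  \sum_(z : {ffun 'I_M1 -> 'I_N} | increasing z)
  \sum_(w : {ffun 'I_M2 -> 'I_N} | increasing w && placement z w)
    Psi (fun i => site R (z i)) (fun k => site R (w k)) *:
      foldr (fun a => flip a blue green)
        (foldr (fun a => flip a red green) (all_green R N) (codom w))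
        (codom z).

(* The momentum p is defined modulo 2 pi, hence only through exp (i p). *)
Definition has_momentum (R : realType) (N M1 M2 : nat) (Psi : wavefun R M1 M2)
    (p : R) :=
  forall (z : {ffun 'I_M1 -> 'I_N}) (w : {ffun 'I_M2 -> 'I_N}),
    placement z w ->
    Psi (fun i => eta R N 1 * site R (z i)) (fun k => eta R N 1 * site R (w k))
    = (cos p +i* sin p) * Psi (fun i => site R (z i)) (fun k => site R (w k)).

Definition Psi0 (R : realType) (M1 M2 : nat) : wavefun R M1 M2 := fun z w =>
  (\prod_(i < M1) \prod_(j < M1 | (i < j)%N) (z i - z j) ^+ 2) *
  (\prod_(k < M2) \prod_(l < M2 | (k < l)%N) (w k - w l) ^+ 2) *
  (\prod_(i < M1) \prod_(k < M2) (z i - w k)) *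
  (\prod_(i < M1) z i) * (\prod_(k < M2) w k).

Definition Psin (R : realType) (N M1 M2 n : nat) : wavefun R M1 M2 := fun z w =>
  N%:R^-1 *
  (\sum_(1 <= g < N.+1)
     (Num.conj (eta R N g)) ^+ n * \prod_(i < M1) (eta R N g - z i)) *
  Psi0 z w.

Definition energy (R : realType) (N M1 n : nat) : R :=
  - (pi ^+ 2 / 18) * (N%:R + 1 / N%:R + 2 / N%:R ^+ 2)
  + 3 * pi ^+ 2 / N%:R ^+ 2 * (M1%:R - n%:R) * n%:R.

Definition energy0 (R : realType) (N : nat) : R :=
  - (pi ^+ 2 / 18) * (N%:R + 7 / N%:R).

Definition dispersion (R : realType) (p : R) : R :=
  3 / 4 * (pi ^+ 2 / 9 - (p - pi) ^+ 2).

Definition momentum (R : realType) (N n : nat) : R :=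
  4 * pi / 3 - 2 * pi / N%:R * (n%:R + 1 / 3).

(* Main.v *)
From HB Require Import structures.
From mathcomp Require Import all_boot all_order all_algebra.
From mathcomp Require Import fingroup perm.
From mathcomp Require Import complex.
From mathcomp Require Import reals trigo.
From mathcomp Require Import ring lra zify.
Require Import Defs.

(*HEADER*)

Set Implicit Arguments.
Unset Strict Implicit.
Unset Printing Implicit Defensive.

Import Order.TTheory GRing.Theory Num.Theory.
Local Open Scope ring_scope.
Local Open Scope complex_scope.

(** On the unit circle 1/|x-y|^2 is the rational function [coupling x y] = -xy/(x-y)^2, and the
    color sum of paired flips transposes two sites; the Hamiltonian is thus a weighted sum of site
    transpositions minus a constant ([hamiltonianE]). The sum over gamma in Psi_n is a discrete
    Fourier inversion ([Psin_coef]): Psi_n is the coefficient of X^n in prod (X - z_i) times Psi_0.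
    This gives the vanishing for n > M_1 and, by homogeneity, the momentum.

    The eigenvalue equation rests on [sum_coupling_horner]: on polynomials of degree at most N,
    lattice convolution with the coupling is a second-order operator in theta = X d/dX. As a
    function of the site to which one particle moves, the amplitude is such a polynomial and
    vanishes on the sites of the other particles, so exchanges with green sites become logarithmic
    derivatives ([amplitude_hop], [ground_amp_hop]). A blue-red exchange becomes a hop of the same
    kind because Psi_0 keeps its value up to sign when the red set is replaced by the equally large
    green set ([ground_amp_swap]).

    Summing over particles leaves two- and three-body sums. The cyclic identity [pole_cycle]
    evaluates enough combinations of them ([three_body], [three_body_cross]) for the rest to cancel
    in [exchange_total]. The coefficients of prod (X - z_i), which are elementary symmetric
    polynomials up to sign, are eigenvectors of the remaining first-order terms
    ([sum_root_coef_setD1], [sum_pole_sum_root_coef_setD1]); this produces (m - n) n.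

    For the spin, a polynomial of degree below N without constant term sums to zero over the
    lattice, whence U^- and V^- annihilate the state. As red and green are equally numerous, the
    commutation relations and the positivity of the inner product give the rest of the 3-bar
    ([lowest_transforms]). The state is nonzero by [exists_root_coef_neq0]. *)

Definition pole (F : fieldType) (x y : F) : F := x / (x - y).
(** Equals 1/|x-y|^2 for distinct points of the unit circle. Since division by 0 gives 0, it
    vanishes on the diagonal, so lattice sums need not exclude the site itself. *)
Definition coupling (F : fieldType) (x y : F) : F := pole x y * pole y x.
(** The Euler operator X d/dX, diagonal on monomials; [locked] keeps it folded during
    simplification. *)
Definition theta (F : fieldType) (p : {poly F}) : {poly F} := locked ('X * p^`()).

Lemma thetaE (F : fieldType) (p : {poly F}) : theta p = 'X * p^`().
Proof. by rewrite /theta -lock. Qed.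

(** * Rational identities for the pole and the coupling *)

Section Hole.
Variable F : fieldType.
Implicit Types x y z : F.

Lemma pole_diag x : pole x x = 0.
Proof. by rewrite /pole subrr invr0 mulr0. Qed.

Lemma coupling_diag x : coupling x x = 0.
Proof. by rewrite /coupling pole_diag mul0r. Qed.

Lemma couplingC x y : coupling x y = coupling y x.
Proof. by rewrite /coupling mulrC. Qed.

Lemma poleC x y : x != y -> pole y x = 1 - pole x y.
Proof.
move=> nxy; rewrite /pole.
have h1 : x - y != 0 by rewrite subr_eq0.
have h2 : y - x != 0 by rewrite subr_eq0 eq_sym.
by field; rewrite h1 h2.
Qed.

(** The identity behind the solvability of inverse-square models: it turns genuine three-body terms
    into constants. *)
Lemma pole_cycle x y z : x != y -> y != z -> z != x ->
  pole x y * pole x z + pole y x * pole y z + pole z x * pole z y = 1.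
Proof.
move=> xy yz zx; rewrite /pole.
have h1 : x - y != 0 by rewrite subr_eq0.
have h2 : y - x != 0 by rewrite subr_eq0 eq_sym.
have h3 : y - z != 0 by rewrite subr_eq0.
have h4 : z - y != 0 by rewrite subr_eq0 eq_sym.
have h5 : z - x != 0 by rewrite subr_eq0.
have h6 : x - z != 0 by rewrite subr_eq0 eq_sym.
by field; rewrite h1 h2 h3 h4 h5 h6.
Qed.

Lemma couplingE x y : coupling x y * (y - x) ^+ 2 = - (x * y) *+ (x != y).
Proof.
rewrite /coupling /pole; case: eqVneq => [->|nxy] /=; first by rewrite subrr expr0n mulr0.
have h1 : x - y != 0 by rewrite subr_eq0.
have h2 : y - x != 0 by rewrite subr_eq0 eq_sym.
by rewrite mulr1n; field; rewrite h1 h2.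
Qed.

Lemma coupling_pole x y : x != 0 -> x != y -> coupling x y * (y / x - 1) = pole x y - 1.
Proof.
move=> x0 nxy; have h1 : x - y != 0 by rewrite subr_eq0.
have h2 : y - x != 0 by rewrite subr_eq0 eq_sym.
rewrite /coupling /pole.
by field; rewrite h1 h2 x0.
Qed.

End Hole.

(** * Lattice sums over the N-th roots of unity *)

Section Lattice.
Variables (F : numFieldType) (N : nat) (om : F).
Hypothesis om_prim : N.-primitive_root om.

Definition pt (a : 'I_N) : F := om ^+ a.+1.

Let N_gt0 : (0 < N)%N := prim_order_gt0 om_prim.
Let N_neq0 : N%:R != 0 :> F. Proof. by rewrite pnatr_eq0 -lt0n. Qed.

Lemma om_neq0 : om != 0.
Proof.
apply/eqP=> om0; have := prim_expr_order om_prim.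
by rewrite om0 expr0n gtn_eqF //= => /esym/eqP; rewrite oner_eq0.
Qed.

Lemma pt_neq0 a : pt a != 0.
Proof. by rewrite expf_neq0 ?om_neq0. Qed.

Lemma pt_exprN a : pt a ^+ N = 1.
Proof. by rewrite /pt exprAC (prim_expr_order om_prim) expr1n. Qed.

Lemma pt_inj : injective pt.
Proof.
move=> a b /eqP; rewrite /pt !exprS (inj_eq (mulfI om_neq0)).
rewrite (eq_prim_root_expr om_prim) !modn_small // => /eqP; exact: val_inj.
Qed.

Lemma prod_pt : \prod_u ('X - (pt u)%:P) = 'X^N - 1 :> {poly F}.
Proof.
transitivity (\prod_(w <- [seq pt u | u : 'I_N]) ('X - w%:P)).
  by rewrite big_map big_enum.
rewrite (@all_roots_prod_XsubC _ ('X^N - 1) [seq pt u | u : 'I_N]).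
- by rewrite (monicP (monicXnsubC 1 N_gt0)) scale1r.
- by rewrite size_XnsubC // size_map -cardE card_ord.
- by apply/allP=> _ /mapP[u _ ->]; rewrite rootE !hornerE pt_exprN subrr.
- by rewrite uniq_rootsE map_inj_uniq ?enum_uniq //; exact: pt_inj.
Qed.

Lemma sum_expr_root (x : F) : x ^+ N = 1 -> x != 1 -> \sum_(m < N) x ^+ m = 0.
Proof.
move=> xN nx1; apply: (mulfI (_ : x - 1 != 0)); first by rewrite subr_eq0.
by rewrite -subrX1 xN subrr mulr0.
Qed.

Lemma sum_pt m : (0 < m < N)%N -> \sum_u pt u ^+ m = 0.
Proof.
case/andP=> m0 mN.
rewrite (eq_bigr (fun u : 'I_N => om ^+ m * (om ^+ m) ^+ u)); last first.
  by move=> u _; rewrite /pt -exprM mulSn exprD mulnC exprM.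
rewrite -mulr_sumr sum_expr_root ?mulr0 //.
  by rewrite exprAC (prim_expr_order om_prim) expr1n.
by rewrite -[1](expr0 om) (eq_prim_root_expr om_prim) mod0n modn_small // -lt0n.
Qed.

Lemma sum_horner_pt (P : {poly F}) :
  (size P <= N)%N -> P`_0 = 0 -> \sum_u P.[pt u] = 0.
Proof.
move=> sP P0; under eq_bigr do rewrite (horner_coef_wide _ sP).
rewrite exchange_big big1 //= => m _; rewrite -mulr_sumr.
have [m0|m0] := posnP m; first by rewrite m0 P0 mul0r.
by rewrite sum_pt ?mulr0 // m0 /=.
Qed.

(** The value of the sum of 1/|eta_a - eta_u|^2 over u != a, as [sum_coupling] shows. *)
Definition coupling_total : F := (N%:R ^+ 2 - 1) / 12.

Section Site.
Variable a : 'I_N.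

Let x u := pt u / pt a.
(** The discrete Fourier transform of the coupling, seen from site [a]. *)
Let T m := \sum_u coupling (pt a) (pt u) * x u ^+ m.

Let xN u : x u ^+ N = 1.
Proof. by rewrite expr_div_n !pt_exprN divr1. Qed.

Let x_eq1 u : (x u == 1) = (u == a).
Proof.
by rewrite -(inj_eq (mulIf (pt_neq0 a))) mulfVK ?pt_neq0 // mul1r (inj_eq pt_inj).
Qed.

Let sum_x m : (0 < m < N)%N -> \sum_u x u ^+ m = 0.
Proof.
move=> h; under eq_bigr do rewrite expr_div_n.
by rewrite -mulr_suml sum_pt // mul0r.
Qed.

(** Multiplying the coupling by (x - 1)^2 gives -x away from x = 1, and the powers x^m over u != a
    sum to -1; hence the second difference of [T] is the constant 1 and [T] is quadratic in m. *)
Let TS m : (0 < m < N)%N -> T m.+1 = T m *+ 2 - T m.-1 + 1.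
Proof.
move=> h; have /andP[m0 mN] := h.
apply/eqP; rewrite -subr_eq0; apply/eqP.
have -> : 1 = \sum_u (x u ^+ m *+ (u != a)) * -1.
  rewrite -mulr_suml (eq_bigr (fun u => x u ^+ m - x u ^+ m *+ (u == a))).
    rewrite sumrB sum_x // (bigD1 a) //= eqxx mulr1n big1 => [|u /negPf->//].
    by rewrite addr0 /x mulfV ?pt_neq0 // expr1n sub0r mulrN1 opprK.
  by move=> u _; case: eqP; rewrite /= ?subrr ?subr0.
rewrite -sumrMnl -sumrB -big_split -sumrB big1 //= => u _.
have [->|nua] := eqVneq u a; first by rewrite coupling_diag /= mulr0n; ring.
have := couplingE (pt a) (pt u); rewrite (inj_eq pt_inj) eq_sym nua mulr1n => hk.
have hk' : coupling (pt a) (pt u) * (x u - 1) ^+ 2 = - x u.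
  rewrite /x; apply: (mulIf (expf_neq0 2 (pt_neq0 a))).
  rewrite -mulrA -exprMn mulrBl mulfVK ?pt_neq0 // mul1r hk.
  by rewrite mulNr mulrC expr2 mulrA mulfVK ?pt_neq0.
rewrite -(prednK m0) /= !exprS mulr1n.
transitivity (x u ^+ m.-1 * (coupling (pt a) (pt u) * (x u - 1) ^+ 2 + x u)); first by ring.
by rewrite hk' addNr mulr0.
Qed.

Let T_closed m : (m <= N)%N ->
  T m = T 0 + m%:R * (T 1 - T 0) + m%:R * (m%:R - 1) / 2.
Proof.
elim/ltn_ind: m => -[|[|m]] IH mN.
- by rewrite !mul0r !addr0.
- by rewrite mul1r subrr mulr0 mul0r addr0 addrC subrK.
have h1 := IH m.+1 (ltnSn _) (ltnW mN).
have h0 := IH m (ltnW (ltnSn _)) (ltnW (ltnW mN)).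
rewrite (@TS m.+1 mN) h1 [_.-1]/= h0 -[m.+2]addn2 -[m.+1]addn1 !natrD; by field.
Qed.

(** Fixed by periodicity: x^N = 1 forces [T N = T 0]. *)
Let T_slope : T 1 - T 0 = (1 - N%:R) / 2.
Proof.
have := T_closed (leqnn N).
have -> : T N = T 0 by apply: eq_bigr => u _; rewrite xN expr0.
move=> h; have : N%:R * (T 1 - T 0) + N%:R * (N%:R - 1) / 2 = 0.
  by apply: (addrI (T 0)); rewrite addr0 addrA -h.
move/eqP; rewrite addr_eq0 => /eqP h'; apply: (mulfI N_neq0); rewrite h'; by field.
Qed.

Lemma sum_pole : \sum_u pole (pt a) (pt u) = (N%:R - 1) / 2.
Proof.
have -> : \sum_u pole (pt a) (pt u) = (T 1 - T 0) + (N%:R - 1).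
  rewrite -sumrB (bigD1 a) //= [in RHS](bigD1 a) //= coupling_diag pole_diag !mul0r subrr !add0r.
  have -> : N%:R - 1 = \sum_(u | u != a) 1 :> F.
    have : \sum_(u < N) 1 = N%:R :> F by rewrite sumr_const card_ord.
    by rewrite (bigD1 a) //= addrC => <-; rewrite addrK.
  rewrite -big_split /=; apply: eq_bigr => u nua.
  by rewrite expr1 expr0 -mulrBr coupling_pole ?pt_neq0 ?(inj_eq pt_inj) 1?eq_sym // subrK.
by rewrite T_slope; by field.
Qed.

(** The last unknown is fixed by summing [T] over a full period: the powers of each x != 1 cancel,
    and x = 1 carries no coupling. *)
Let T0 : T 0 = coupling_total.
Proof.
have : \sum_(m < N) T m = 0.
  rewrite exchange_big big1 //= => u _; rewrite -mulr_sumr.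
  have [->|nua] := eqVneq u a; first by rewrite coupling_diag mul0r.
  by rewrite sum_expr_root ?mulr0 // x_eq1.
have S n : (n <= N)%N -> \sum_(m < n) T m =
    n%:R * T 0 - n%:R * (n%:R - 1) * (N%:R - 1) / 4
      + n%:R * (n%:R - 1) * (n%:R - 2) / 6.
  elim: n => [|n IH] nN; first by rewrite big_ord0; by field.
  rewrite big_ord_recr /= IH ?(ltnW nN) // (T_closed (ltnW nN)) T_slope -natr1.
  by field.
rewrite S // => h; apply: (mulfI N_neq0); apply/eqP; rewrite -subr_eq0 -h /coupling_total; apply/eqP.
by field.
Qed.

Lemma sum_coupling_expr m : (m <= N)%N -> \sum_u coupling (pt a) (pt u) * pt u ^+ m =
  pt a ^+ m * (coupling_total - m%:R * (N%:R - m%:R) / 2).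
Proof.
move=> mN; transitivity (pt a ^+ m * T m).
  rewrite mulr_sumr; apply: eq_bigr => u _; rewrite mulrCA -exprMn mulrCA.
  by rewrite mulfV ?pt_neq0 // mulr1.
by rewrite (T_closed mN) T_slope T0; congr (_ * _); by field.
Qed.

Lemma sum_coupling : \sum_u coupling (pt a) (pt u) = coupling_total.
Proof. by have := @sum_coupling_expr 0 isT; rewrite !(expr0, mul0r, subr0, mul1r) => <-; under eq_bigr do rewrite -[coupling _ _]mulr1. Qed.

(** By linearity from monomials: X^i has eigenvalue c0 - i(N-i)/2, and theta multiplies X^i by i.
    The degree may be as large as N. *)
Lemma sum_coupling_horner (P : {poly F}) : (size P <= N.+1)%N ->
  \sum_u coupling (pt a) (pt u) * P.[pt u] =
  coupling_total * P.[pt a] + ((theta (theta P)).[pt a] - N%:R * (theta P).[pt a]) / 2.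
Proof.
move=> sP; under eq_bigr do rewrite (horner_coef_wide _ sP) mulr_sumr.
have theta_poly (Q : {poly F}) : (size Q <= N.+1)%N -> theta Q = \poly_(i < N.+1) (Q`_i * i%:R).
  move=> sQ; apply/polyP=> i; rewrite thetaE coefXM coef_deriv coef_poly.
  case: i => [|i]; first by rewrite mulr_natr mulr0n.
  rewrite ltnS /= mulr_natr; case: ltnP => // h.
  by rewrite nth_default ?mul0rn // (leq_trans sQ).
have s1 : (size (theta P) <= N.+1)%N by rewrite theta_poly // size_poly.
rewrite exchange_big [theta (theta P)]theta_poly // [theta P]theta_poly // (horner_coef_wide _ sP) !horner_poly.
rewrite !mulr_sumr -sumrB mulr_suml -big_split /=; apply: eq_bigr => i _.
rewrite coef_poly ltn_ord.
rewrite (eq_bigr (fun u => P`_i * (coupling (pt a) (pt u) * pt u ^+ i))); last by move=> u _; ring.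
by rewrite -mulr_sumr (sum_coupling_expr (ltn_ord i : i <= N)%N); field.
Qed.

End Site.
End Lattice.

(** * Logarithmic derivatives under the Euler operator *)

Section LogDerivative.
Variable F : fieldType.
Implicit Types (p q : {poly F}) (x w : F).

Lemma thetaM p q : theta (p * q) = theta p * q + p * theta q.
Proof. by rewrite !thetaE derivM; ring. Qed.

Lemma thetaD p q : theta (p + q) = theta p + theta q.
Proof. by rewrite !thetaE derivD mulrDr. Qed.

Lemma coef_theta p i : (theta p)`_i = i%:R * p`_i.
Proof.
by rewrite !thetaE coefXM coef_deriv; case: i => [|i] /=; rewrite ?mul0r // mulr_natl.
Qed.

(** A is the logarithmic derivative theta p / p at x and B is theta of it, written without division.
    Both add up over products. *)
Definition logd p x A B :=
  (theta p).[x] = A * p.[x] /\ (theta (theta p)).[x] = (A ^+ 2 + B) * p.[x].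

Lemma logdM p q x A B A' B' :
  logd p x A B -> logd q x A' B' -> logd (p * q) x (A + A') (B + B').
Proof.
case=> [p1 p2] [q1 q2]; split; rewrite !(thetaM, thetaD) !(hornerD, hornerM) ?p2 ?q2 p1 q1; ring.
Qed.

Lemma logd_prod (I : finType) (P : pred I) (p : I -> {poly F}) x A B :
  (forall i, P i -> logd (p i) x (A i) (B i)) ->
  logd (\prod_(i | P i) p i) x (\sum_(i | P i) A i) (\sum_(i | P i) B i).
Proof.
move=> h; elim/big_rec3: _ => [|i b a q Pi hq]; last exact: logdM (h i Pi) hq.
by split; rewrite !thetaE -[1]/(1%:P) derivC mulr0 ?deriv0 ?mulr0 horner0; ring.
Qed.

Lemma logdX x : logd 'X x 1 0.
Proof. by split; rewrite !thetaE !derivX !mulr1 ?derivX ?hornerE //; ring. Qed.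

Lemma logdXsubC x w : x != w -> logd ('X - w%:P) x (pole x w) (coupling x w).
Proof.
move=> nxw; have h : pole x w * (x - w) = x by rewrite /pole mulfVK ?subr_eq0.
have hk : pole x w ^+ 2 + coupling x w = pole x w by rewrite /coupling (poleC nxw); ring.
by split; rewrite !thetaE derivXsubC !mulr1 ?derivX ?mulr1 !hornerE ?hk h.
Qed.

End LogDerivative.

(** * Amplitudes on sets of sites and single-particle hops *)

Section Amplitude.
Variables (F : numFieldType) (N : nat) (om : F).
Hypothesis om_prim : N.-primitive_root om.
Implicit Types (B R : {set 'I_N}) (a k u : 'I_N).

Notation z := (pt om).

(** Taken over ordered pairs: the squared Vandermonde product up to a sign depending only on the
    size of [B], with no choice of ordering. *)
Definition vand2 B : F := \prod_(a in B) \prod_(b in B | b != a) (z a - z b).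
Definition cross B R : F := \prod_(a in B) \prod_(k in R) (z a - z k).
Definition ground_amp B R : F :=
  vand2 B * vand2 R * cross B R * \prod_(a in B) z a * \prod_(k in R) z k.
Definition root_poly B : {poly F} := \prod_(a in B) ('X - (z a)%:P).
(** Up to sign, the elementary symmetric polynomial of degree |B| - n in the blue coordinates. *)
Definition root_coef n B : F := (root_poly B)`_n.
Definition amplitude n B R : F := root_coef n B * ground_amp B R.
(** The dependence of Psi_0 on the coordinate of one more particle with the color of [B]: see
    [ground_amp_setU1]. *)
Definition particle_poly B R : {poly F} := 'X * root_poly B ^+ 2 * root_poly R.

Definition pole_sum B a : F := \sum_(b in B) pole (z a) (z b).
Definition coupling_sum B a : F := \sum_(b in B) coupling (z a) (z b).

Lemma size_root_poly B : size (root_poly B) = #|B|.+1.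
Proof.
rewrite /root_poly -big_enum /= -(big_map z predT (fun w => 'X - w%:P)).
by rewrite size_prod_XsubC size_map -cardE.
Qed.

Lemma horner_root_poly B x : (root_poly B).[x] = \prod_(a in B) (x - z a).
Proof. by rewrite horner_prod; apply: eq_bigr => a _; rewrite !hornerE. Qed.

Lemma root_poly_eq0 B u : (root_poly B).[z u] == 0 = (u \in B).
Proof.
rewrite horner_root_poly; apply/prodf_eq0/idP => [[a aB]|uB]; last by exists u; rewrite ?subrr.
by rewrite subr_eq0 (inj_eq (pt_inj om_prim)) => /eqP->.
Qed.

Lemma vand2_setU1 a B : a \notin B ->
  vand2 (a |: B) = (-1) ^+ #|B| * (root_poly B).[z a] ^+ 2 * vand2 B.
Proof.
move=> aB; rewrite /vand2 big_setU1 //=.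
have nb b : b \in B -> b != a by apply: contraTneq => ->.
rewrite (eq_bigl (mem B)) => [|b]; last first.
  by rewrite in_setU1; case: eqVneq => [->|] //=; rewrite ?(negPf aB) ?andbT.
rewrite [X in _ * X](eq_bigr (fun b => - (z a - z b) *
   \prod_(b' in B | b' != b) (z b - z b'))); last first.
  move=> b bB; rewrite (bigD1 a) ?setU11 /=; last by rewrite eq_sym nb.
  rewrite opprB; congr (_ * _); apply: eq_bigl => b'.
  by rewrite in_setU1; case: (eqVneq b' a) => [->|] /=; rewrite ?andbF ?(negPf aB) ?andbT.
rewrite big_split /= prodrN horner_root_poly; ring.
Qed.

Lemma crossN B R : cross R B = (-1) ^+ (#|B| * #|R|) * cross B R.
Proof.
rewrite /cross exchange_big /= mulnC exprM -prodr_const -big_split /=.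
apply: eq_bigr => a _; rewrite -prodr_const -big_split /=.
by apply: eq_bigr => k _; rewrite mulN1r opprB.
Qed.

Lemma ground_ampC B R : ground_amp R B = (-1) ^+ (#|B| * #|R|) * ground_amp B R.
Proof. by rewrite /ground_amp crossN; ring. Qed.

Lemma ground_amp_setU1 a B R : a \notin B ->
  ground_amp (a |: B) R = (-1) ^+ #|B| * ground_amp B R * (particle_poly B R).[z a].
Proof.
move=> aB; rewrite /ground_amp vand2_setU1 // /cross !big_setU1 //= -horner_root_poly /particle_poly.
by rewrite !(hornerM, hornerX, horner_exp); ring.
Qed.

Lemma root_poly_setU1 a B : a \notin B -> root_poly (a |: B) = ('X - (z a)%:P) * root_poly B.
Proof. by move=> aB; rewrite /root_poly big_setU1. Qed.

Lemma root_coef_setU1 n a B : a \notin B ->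
  root_coef n (a |: B) = ('X * root_poly B)`_n - z a * (root_poly B)`_n.
Proof. by move=> aB; rewrite /root_coef root_poly_setU1 // mulrBl coefB coefCM. Qed.

Lemma logd_root_poly B x : (forall b, b \in B -> x != z b) ->
  logd (root_poly B) x (\sum_(b in B) pole x (z b)) (\sum_(b in B) coupling x (z b)).
Proof. by move=> h; apply: logd_prod => b bB; apply: logdXsubC; apply: h. Qed.

Lemma logd_particle_poly B R a : a \in B -> [disjoint B & R] ->
  logd (particle_poly (B :\ a) R) (z a) (1 + 2 * pole_sum B a + pole_sum R a)
                               (2 * coupling_sum B a + coupling_sum R a).
Proof.
move=> aB dBR.
have hB b : b \in B :\ a -> z a != z b.
  by rewrite in_setD1 (inj_eq (pt_inj om_prim)) eq_sym => /andP[].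
have hR b : b \in R -> z a != z b.
  rewrite (inj_eq (pt_inj om_prim)); apply: contraTneq => <-.
  by rewrite (disjointFr dBR aB).
have -> : pole_sum B a = \sum_(b in B :\ a) pole (z a) (z b).
  by rewrite /pole_sum (big_setD1 a) //= pole_diag add0r.
have -> : coupling_sum B a = \sum_(b in B :\ a) coupling (z a) (z b).
  by rewrite /coupling_sum (big_setD1 a) //= coupling_diag add0r.
have := logdM (logdM (logdX _) (logdM (logd_root_poly hB) (logd_root_poly hB))) (logd_root_poly hR).
rewrite -expr2 -/(particle_poly _ _); congr (logd _ _ _ _); rewrite /pole_sum /coupling_sum; ring.
Qed.

Lemma size_particle_poly B R : (size (particle_poly B R) <= (2 * #|B| + #|R|).+2)%N.
Proof.
rewrite /particle_poly; apply: leq_trans (size_polyMleq _ _) _.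
rewrite size_root_poly addnS /= -ltnS.
apply: leq_ltn_trans (leq_add (size_polyMleq _ _) (leqnn _)) _.
rewrite size_polyX expr2.
have := size_polyMleq (root_poly B) (root_poly B); rewrite size_root_poly /=; lia.
Qed.

Lemma particle_poly_eq0 B R u : u \in B :|: R -> (particle_poly B R).[z u] = 0.
Proof.
rewrite in_setU -!root_poly_eq0 /particle_poly expr2 !hornerM.
by case/orP=> /eqP ->; rewrite !(mulr0, mul0r).
Qed.

(** The polynomial of the moving particle times an affine factor has degree at most N, so
    [sum_coupling_horner] applies. The derivatives at the original site are read off from the
    logarithmic derivatives [A] and [K]. *)
Lemma hop_core B R a (al be : F) :
  a \in B -> [disjoint B & R] -> (2 * #|B| + #|R| <= N)%N ->
  let A := 1 + 2 * pole_sum B a + pole_sum R a in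
  let K := 2 * coupling_sum B a + coupling_sum R a in
  \sum_(u | u \notin B :|: R)
     coupling (z a) (z u) * ((particle_poly (B :\ a) R).[z u] * (al + be * z u)) =
  (particle_poly (B :\ a) R).[z a] *
   (coupling_total F N * (al + be * z a) +
    ((A ^+ 2 + K - N%:R * A) * (al + be * z a)
      + (2 * A + 1 - N%:R) * (be * z a)) / 2).
Proof.
move=> aB dBR sz A K; have [G1 G2] := logd_particle_poly aB dBR; rewrite -/A -/K in G1 G2.
set G := particle_poly _ _ in G1 G2 *; pose f := al%:P + be *: 'X : {poly F}.
have tf : theta f = be *: 'X.
  by rewrite !thetaE derivD derivC derivZ derivX add0r alg_polyC -mul_polyC mulrC.
have ttf : theta (theta f) = be *: 'X.
  by rewrite tf thetaE derivZ derivX alg_polyC -mul_polyC mulrC.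
have fE x : f.[x] = al + be * x by rewrite !hornerE.
have Gz u : u \in B :\ a :|: R -> G.[z u] = 0 by move=> h; apply: particle_poly_eq0.
have sf : (size f <= 2)%N.
  apply: leq_trans (size_polyD _ _) _; rewrite geq_max.
  apply/andP; split; first exact: leq_trans (size_polyC_leq1 _) _.
  by apply: leq_trans (size_scale_leq _ _) _; rewrite size_polyX.
have sG : (size (G * f)%R <= N.+1)%N.
  apply: leq_trans (size_polyMleq _ _) _; have := size_particle_poly (B :\ a) R.
  rewrite -/G; have cB : #|B| = #|B :\ a|.+1 by rewrite (cardsD1 a) aB.
  clear -cB sz sf; clearbody f; move: (size G) (size f) sf sz => m m'.
  by rewrite cB; lia.
clearbody G f.
(* The sum extends to all sites: the polynomial vanishes at the other particles, and the coupling
   vanishes at [a] itself. *)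
transitivity (\sum_(u < N) coupling (z a) (z u) * (G * f).[z u]).
  rewrite [RHS](bigID (fun u => u \notin B :|: R)) /= [X in _ + X]big1.
    by rewrite addr0; apply: eq_bigr => u _; rewrite hornerM fE.
  move=> u; rewrite negbK => uBR; have [->|nua] := eqVneq u a.
    by rewrite coupling_diag mul0r.
  by rewrite hornerM Gz ?mul0r ?mulr0 // in_setU in_setD1 nua -in_setU.
rewrite sum_coupling_horner // !(thetaM, thetaD) ttf tf.
by rewrite !(hornerD, hornerM, hornerZ, hornerX) G2 G1 fE; field.
Qed.

(** [root_coef n] of the moved set is affine in the new coordinate, with slope
    [- root_coef n (B :\ a)]; this supplies the affine factor of [hop_core], whose value at [a] is
    [root_coef n B]. *)
Lemma amplitude_hop n B R a :
  a \in B -> [disjoint B & R] -> (2 * #|B| + #|R| <= N)%N ->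
  let A := 1 + 2 * pole_sum B a + pole_sum R a in
  let K := 2 * coupling_sum B a + coupling_sum R a in
  \sum_(u | u \notin B :|: R) coupling (z a) (z u) * amplitude n (u |: B :\ a) R =
  ground_amp B R *
   (coupling_total F N * root_coef n B +
    ((A ^+ 2 + K - N%:R * A) * root_coef n B
      + (2 * A + 1 - N%:R) * - (z a * root_coef n (B :\ a))) / 2).
Proof.
move=> aB dBR sz A K.
have aD : a \notin B :\ a by rewrite setD11.
have BE : a |: B :\ a = B by rewrite setD1K.
have e : root_coef n B = ('X * root_poly (B :\ a))`_n - z a * root_coef n (B :\ a).
  by rewrite -{1}BE root_coef_setU1.
have e0 : ground_amp B R = (-1) ^+ #|B :\ a| * ground_amp (B :\ a) R * (particle_poly (B :\ a) R).[z a].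
  by rewrite -{1}BE ground_amp_setU1.
have := hop_core ('X * root_poly (B :\ a))`_n (- root_coef n (B :\ a)) aB dBR sz.
rewrite -/A -/K /= => h.
rewrite (eq_bigr (fun u => (-1) ^+ #|B :\ a| * ground_amp (B :\ a) R *
  (coupling (z a) (z u) * ((particle_poly (B :\ a) R).[z u] *
    (('X * root_poly (B :\ a))`_n + - root_coef n (B :\ a) * z u))))); last first.
  move=> u; rewrite in_setU negb_or => /andP[uB _].
  have uD : u \notin B :\ a by rewrite in_setD1 (negPf uB) andbF.
  by rewrite /amplitude root_coef_setU1 // ground_amp_setU1 // -/(root_coef n (B :\ a)); ring.
by rewrite -mulr_sumr h e0 e; ring.
Qed.

(** The red hop is the blue one with the roles of the two colors exchanged, at the price of a sign.
    The affine factor is the constant 1, since [root_coef] does not involve red. *)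
Lemma ground_amp_hop B R k :
  k \in R -> [disjoint B & R] -> (2 * #|R| + #|B| <= N)%N ->
  let A := 1 + 2 * pole_sum R k + pole_sum B k in
  let K := 2 * coupling_sum R k + coupling_sum B k in
  \sum_(u | u \notin B :|: R) coupling (z k) (z u) * ground_amp B (u |: R :\ k) =
  ground_amp B R * (coupling_total F N + (A ^+ 2 + K - N%:R * A) / 2).
Proof.
move=> kR; rewrite disjoint_sym => dBR sz A K.
have kD : k \notin R :\ k by rewrite setD11.
have RE : k |: R :\ k = R by rewrite setD1K.
have e0 : ground_amp R B = (-1) ^+ #|R :\ k| * ground_amp (R :\ k) B * (particle_poly (R :\ k) B).[z k].
  by rewrite -{1}RE ground_amp_setU1.
have := hop_core 1 0 kR dBR sz; rewrite -/A -/K /= => h.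
rewrite (eq_bigr (fun u => (-1) ^+ (#|R| * #|B|) * ((-1) ^+ #|R :\ k| * ground_amp (R :\ k) B) *
  (coupling (z k) (z u) * ((particle_poly (R :\ k) B).[z u] * (1 + 0 * z u))))); last first.
  move=> u; rewrite in_setU negb_or => /andP[_ uR].
  have uD : u \notin R :\ k by rewrite in_setD1 (negPf uR) andbF.
  have cu : #|u |: R :\ k| = #|R| by rewrite cardsU1 uD [in RHS](cardsD1 k) kR.
  by rewrite ground_ampC cu ground_amp_setU1 //; ring.
by rewrite -mulr_sumr setUC h [ground_amp B R]ground_ampC e0; ring.
Qed.

End Amplitude.

(** * Two- and three-body sums, and red-green symmetry of the ground amplitude *)

Section ManyBody.
Variables (F : numFieldType) (N : nat) (om : F).
Hypothesis om_prim : N.-primitive_root om.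
Implicit Types (B R G : {set 'I_N}) (a k u : 'I_N).

Notation z := (@pt F N om).
Notation rootp := (root_poly om).
Notation phi := (root_coef om).
Notation Spole := (pole_sum om).
Notation Scoupling := (coupling_sum om).
Notation amp0 := (ground_amp om).
Notation amp := (amplitude om).
Notation c0 := (coupling_total F N).

Let z_eq := inj_eq (pt_inj om_prim).

Let sum_card B (x : F) : \sum_(a in B) x = #|B|%:R * x.
Proof. by rewrite sumr_const mulr_natl. Qed.

Let cardD1R B a : a \in B -> #|B :\ a|%:R = #|B|%:R - 1 :> F.
Proof. by move=> aB; rewrite (cardsD1 a B) aB natrD addrC addKr. Qed.

Lemma root_poly_setD1 B a : a \in B -> rootp B = ('X - (z a)%:P) * rootp (B :\ a).
Proof. by move=> aB; rewrite -root_poly_setU1 ?setD11 // setD1K. Qed.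

Lemma theta_root_poly B : theta (rootp B) = \sum_(a in B) 'X * rootp (B :\ a).
Proof.
move: {2}#|B| (erefl #|B|) => m; elim: m B => [|m IH] B cB.
  by rewrite (cards0_eq cB) /root_poly !big_set0 thetaE -[1]/(1%:P) derivC mulr0.
have [a aB] : exists a, a \in B by apply/set0Pn; rewrite -cards_eq0 cB.
have cB' : #|B :\ a| = m by move: cB; rewrite (cardsD1 a) aB => -[].
rewrite (root_poly_setD1 aB) thetaM IH // thetaE derivXsubC mulr1 [RHS](big_setD1 a) //=.
congr (_ + _); rewrite mulr_sumr; apply: eq_bigr => b.
rewrite in_setD1 => /andP[ba bB].
rewrite (@root_poly_setD1 (B :\ b) a); last by rewrite in_setD1 eq_sym ba.
have -> : B :\ b :\ a = B :\ a :\ b by apply/setP=> x; rewrite !in_setD1 andbCA.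
by rewrite mulrCA.
Qed.

(** Euler's homogeneity relation: [- phi n (B :\ a)] is the derivative of [phi n B] in z_a, and
    [phi n B] is homogeneous of degree |B| - n. *)
Lemma sum_root_coef_setD1 n B :
  \sum_(a in B) - (z a * phi n (B :\ a)) = (#|B|%:R - n%:R) * phi n B.
Proof.
have := coef_theta (rootp B) n; rewrite theta_root_poly => h.
rewrite mulrBl -[n%:R * _]h mulr_natl -sumr_const coef_sum -sumrB.
apply: eq_bigr => a aB; rewrite {2}/root_coef (root_poly_setD1 aB).
by rewrite mulrBl coefB coefCM; rewrite /root_coef; ring.
Qed.

(** The two-body drift operator is diagonal on elementary symmetric polynomials: symmetrizing a pair
    cancels its denominator and leaves coefficients of X^2 times the second derivative of the root
    polynomial. *)
Lemma sum_pole_sum_root_coef_setD1 n B :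
  \sum_(a in B) Spole B a * - (z a * phi n (B :\ a)) =
    (#|B|%:R * (#|B|%:R - 1) - n%:R * (n%:R - 1)) / 2 * phi n B.
Proof.
set S := LHS.
pose f a b := pole (z a) (z b) * - (z a * phi n (B :\ a)).
have e1 : S = \sum_(a in B) \sum_(b in B) f a b.
  by apply: eq_bigr => a _; rewrite mulr_suml.
have e2 : S = \sum_(a in B) \sum_(b in B) f b a by rewrite e1 exchange_big.
pose r2 a b := ('X * ('X * rootp (B :\ a :\ b)))`_n.
(* For a pair a != b everything is linear in the coefficients of the common factor q, the root
   polynomial of the remaining sites. *)
have e3 : S + S = \sum_(a in B) \sum_(b in B :\ a) (phi n B - r2 a b).
  rewrite {1}e1 e2 -big_split; apply: eq_bigr => a aB.
  rewrite -big_split /= (big_setD1 a) //= {1 2}/f pole_diag !mul0r !add0r.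
  apply: eq_bigr => b; rewrite in_setD1 => /andP[ba bB].
  have nab : z a != z b by rewrite z_eq eq_sym.
  have bD : b \in B :\ a by rewrite in_setD1 ba.
  have aD : a \in B :\ b by rewrite in_setD1 eq_sym ba.
  have cD : B :\ b :\ a = B :\ a :\ b by apply/setP=> x; rewrite !in_setD1 andbCA.
  rewrite /f /r2 /root_coef (root_poly_setD1 aB) (root_poly_setD1 bD) (root_poly_setD1 aD) cD.
  set q := rootp _.
  have -> : ('X - (z a)%:P) * (('X - (z b)%:P) * q) =
     'X * ('X * q) - (z a + z b) *: ('X * q) + (z a * z b) *: q.
    by rewrite -!mul_polyC !polyCD !polyCM; ring.
  rewrite !mulrBl !(coefD, coefN, coefZ, coefCM) /pole.
  have h1 : z a - z b != 0 by rewrite subr_eq0.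
  have h2 : z b - z a != 0 by rewrite subr_eq0 eq_sym.
  by field; rewrite h1 h2.
(* This is theta^2 = theta + X^2 d^2/dX^2, so the double sum has n-th coefficient n(n-1)
   [phi n B]. *)
have tt : theta (theta (rootp B)) =
    theta (rootp B) + \sum_(a in B) \sum_(b in B :\ a) 'X * ('X * rootp (B :\ a :\ b)).
  rewrite {1}theta_root_poly.
  have -> : forall p : 'I_N -> {poly F},
      theta (\sum_(a in B) p a) = \sum_(a in B) theta (p a).
    move=> p; elim/big_rec2: _ => [|i x y _ <-]; last by rewrite thetaD.
    by rewrite thetaE deriv0 mulr0.
  rewrite [X in _ = X + _]theta_root_poly -big_split; apply: eq_bigr => a aB /=.
  rewrite thetaM theta_root_poly thetaE derivX mulr1; congr (_ + _).
  by rewrite mulr_sumr.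
have := congr1 (fun p : {poly F} => p`_n) tt.
rewrite /= coefD !coef_theta -/(phi n B) => h.
have e4 : \sum_(a in B) \sum_(b in B :\ a) r2 a b = n%:R * (n%:R - 1) * phi n B.
  transitivity ((\sum_(a in B) \sum_(b in B :\ a) 'X * ('X * rootp (B :\ a :\ b)))`_n).
    by rewrite coef_sum; apply: eq_bigr => a _; rewrite coef_sum.
  by apply: (addrI (n%:R * phi n B)); rewrite -h; ring.
have e5 : \sum_(a in B) \sum_(b in B :\ a) phi n B = #|B|%:R * (#|B|%:R - 1) * phi n B.
  rewrite (eq_bigr (fun=> (#|B|%:R - 1) * phi n B)).
    by rewrite sum_card mulrA.
  by move=> a aB; rewrite sum_card cardD1R.
have e6 : S + S = (#|B|%:R * (#|B|%:R - 1) - n%:R * (n%:R - 1)) * phi n B.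
  by rewrite e3 mulrBl -e4 -e5 -sumrB; apply: eq_bigr => a _; rewrite sumrB.
have -> : S = (S + S) / 2 by field.
by rewrite e6; field.
Qed.

(** The derivative of X^N - 1 at z_k, computed from its two factored forms. *)
Lemma prod_diff k : \prod_(u | u != k) (z k - z u) = N%:R * z k ^+ N.-1.
Proof.
have := congr1 (fun p => (p^`()).[z k]) (prod_pt om_prim).
rewrite /= (bigD1 k) //= derivM derivXsubC mul1r derivB derivXn derivC subr0.
rewrite hornerD hornerM hornerXsubC subrr mul0r addr0 horner_prod hornerMn hornerXn.
rewrite -mulr_natl => <-; apply: eq_bigr => u _; by rewrite hornerXsubC.
Qed.

(* The products over the red and the green sites complete each red site to the
   full lattice product N z^(N-1). *)
Lemma ground_amp_cross B R G : (forall u, u \in G = (u \notin B :|: R)) -> [disjoint B & R] ->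
  amp0 B R * cross om R G =
    vand2 om B * (\prod_(a in B) z a) * ((-1) ^+ #|B| * N%:R) ^+ #|R|.
Proof.
move=> GE dBR; have N0 : (0 < N)%N := prim_order_gt0 om_prim.
have -> : ((-1) ^+ #|B| * N%:R) ^+ #|R| = \prod_(k in R)
    ((\prod_(l in R | l != k) (z k - z l)) * (\prod_(a in B) (z a - z k)) * z k *
     \prod_(g in G) (z k - z g)).
  rewrite -prodr_const; apply: eq_bigr => k kR.
  have -> : \prod_(a in B) (z a - z k) = (-1) ^+ #|B| * \prod_(a in B) (z k - z a).
    by rewrite -prodrN; apply: eq_bigr => a _; rewrite opprB.
  have := prod_diff k; rewrite (bigID (fun l => l \in R)) /= [X in _ * X](bigID (fun l => l \in B)) /=.
  rewrite (eq_bigl (fun l => (l \in R) && (l != k))) => [|l]; last by rewrite andbC.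
  rewrite [X in _ * (X * _)](eq_bigl (fun l => l \in B)) => [|l]; last first.
    case lB: (l \in B); last by rewrite andbF.
    rewrite (disjointFr dBR lB) !andbT.
    by apply: contraTneq kR => <-; rewrite (disjointFr dBR lB).
  rewrite [X in _ * (_ * X)](eq_bigl (fun l => l \in G)) => [|l]; last first.
    rewrite /= GE in_setU negb_or; case: eqVneq => [->|_] /=; last by rewrite andbC.
    by rewrite kR andbF.
  move=> h; transitivity ((-1) ^+ #|B| * (N%:R * (z k * z k ^+ N.-1))).
    by rewrite -exprS prednK // pt_exprN // mulr1.
  by rewrite [N%:R * _]mulrCA -h; ring.
rewrite !big_split /= /ground_amp /vand2 /cross [\prod_(a in B) \prod_(k in R) _]exchange_big /=.
by ring.
Qed.

(** By [ground_amp_cross], the product with the red-green cross factor depends only on [B] and the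
    number of red sites. Applying this with red and green interchanged and cancelling the nonzero
    cross factor leaves the sign of reversing its |R|^2 differences. *)
Lemma ground_amp_swap B R G : (forall u, u \in G = (u \notin B :|: R)) -> [disjoint B & R] ->
  #|G| = #|R| -> amp0 B G = (-1) ^+ #|R| * amp0 B R.
Proof.
move=> GE dBR cG.
have RE u : u \in R = (u \notin B :|: G).
  rewrite in_setU GE in_setU; case uB: (u \in B); rewrite /= ?negbK //.
  exact: disjointFr dBR uB.
have dBG : [disjoint B & G].
  by apply/pred0P => u /=; rewrite GE in_setU; case: (u \in B).
have nz : cross om R G != 0.
  rewrite /cross; apply/prodf_neq0 => k kR; apply/prodf_neq0 => g gG.
  by rewrite subr_eq0 z_eq; apply: contraTneq gG => <-; rewrite GE in_setU kR orbT.
have h1 := ground_amp_cross GE dBR; have := ground_amp_cross RE dBG.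
rewrite crossN cG -h1 mulrCA mulrA => /(mulIf nz) h.
rewrite -h mulrA -exprD -signr_odd oddD oddM andbb addbb /= expr0 mul1r.
by [].
Qed.

Lemma sum_sum_pole B : \sum_(a in B) Spole B a = #|B|%:R * (#|B|%:R - 1) / 2.
Proof.
set S := LHS.
have e : S + S = #|B|%:R * (#|B|%:R - 1).
  rewrite {2}/S /pole_sum exchange_big -big_split /=.
  rewrite (eq_bigr (fun=> #|B|%:R - 1)) => [|a aB].
    by rewrite sum_card.
  rewrite -big_split /= (big_setD1 a) //= pole_diag !add0r.
  rewrite (eq_bigr (fun=> 1)) => [|b]; last first.
    by rewrite in_setD1 => /andP[ba _]; rewrite (@poleC _ (z a)) ?z_eq 1?eq_sym //; ring.
  by rewrite sum_card cardD1R // mulr1.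
have -> : S = (S + S) / 2 by field.
by rewrite e.
Qed.

Lemma sum_cross_pole B R : [disjoint B & R] ->
  \sum_(k in R) Spole B k = #|B|%:R * #|R|%:R - \sum_(a in B) Spole R a.
Proof.
move=> dBR; apply/eqP; rewrite eq_sym subr_eq; apply/eqP.
rewrite /pole_sum [\sum_(k in R) _]exchange_big -big_split /=.
rewrite mulr_natl -sumr_const; apply: eq_bigr => a aB.
rewrite -big_split /= -sumr_const; apply: eq_bigr => k kR.
rewrite (@poleC _ (z a)) ?subrK // z_eq; apply: contraTneq kR => <-.
by rewrite (disjointFr dBR aB).
Qed.

Let pole_sqr x y : pole (z x) (z y) ^+ 2 = pole (z x) (z y) - coupling (z x) (z y).
Proof.
have [->|nxy] := eqVneq x y; first by rewrite coupling_diag pole_diag expr2 mul0r subr0.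
by rewrite /coupling (@poleC _ (z x)) ?z_eq //; ring.
Qed.

(** Since pole^2 = pole - coupling, the coinciding red indices drop out of the first sum;
    symmetrizing the second in its two red sites completes the cyclic triple of [pole_cycle] for
    each blue site and ordered pair of red sites. *)
Lemma three_body_cross B R : [disjoint B & R] ->
  \sum_(a in B) (Spole R a ^+ 2 + Scoupling R a - Spole R a)
    + 2 * \sum_(k in R) Spole R k * Spole B k = #|B|%:R * #|R|%:R * (#|R|%:R - 1).
Proof.
move=> dBR.
have nBR a k : a \in B -> k \in R -> z a != z k.
  by move=> aB kR; rewrite z_eq; apply: contraTneq kR => <-; rewrite (disjointFr dBR aB).
have e1 a : a \in B -> Spole R a ^+ 2 + Scoupling R a - Spole R a =
   \sum_(k in R) \sum_(l in R :\ k) pole (z a) (z k) * pole (z a) (z l).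
  move=> aB; rewrite expr2 /pole_sum /coupling_sum mulr_suml -big_split -sumrB /=.
  apply: eq_bigr => k kR; rewrite (big_setD1 k kR) /= mulrDr -expr2 pole_sqr -[RHS]mulr_sumr.
  by ring.
have e2 : 2 * \sum_(k in R) Spole R k * Spole B k = \sum_(a in B) \sum_(k in R)
   \sum_(l in R :\ k) (pole (z k) (z l) * pole (z k) (z a) + pole (z l) (z k) * pole (z l) (z a)).
  have sum_off (f : 'I_N -> 'I_N -> F) :
      \sum_(k in R) \sum_(l in R :\ k) f k l = \sum_(k in R) \sum_(l in R :\ k) f l k.
    rewrite (exchange_big_dep (mem R)) /= => [|k l _]; last by case/setD1P.
    apply: eq_bigr => k kR; apply: eq_bigl => l.
    by rewrite !in_setD1 kR andbT eq_sym andbC.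
  have -> : \sum_(k in R) Spole R k * Spole B k =
      \sum_(a in B) \sum_(k in R) \sum_(l in R :\ k) pole (z k) (z l) * pole (z k) (z a).
    rewrite exchange_big; apply: eq_bigr => k kR /=; rewrite mulr_sumr.
    apply: eq_bigr => a aB; rewrite /pole_sum mulr_suml (big_setD1 k kR) /=.
    by rewrite pole_diag mul0r add0r.
  rewrite mulr_sumr; apply: eq_bigr => a aB.
  rewrite mulrDl mul1r {2}sum_off -big_split; apply: eq_bigr => k kR.
  by rewrite -big_split.
rewrite e2 (eq_bigr _ e1) -big_split /=.
rewrite (eq_bigr (fun=> #|R|%:R * (#|R|%:R - 1))).
  by rewrite sum_card mulrA.
move=> a aB; rewrite -big_split /= (eq_bigr (fun=> #|R|%:R - 1)).
  by rewrite sum_card.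
move=> k kR; rewrite -big_split /= (eq_bigr (fun=> 1)).
  by rewrite sum_card cardD1R // mulr1.
move=> l; rewrite in_setD1 => /andP[lk lR].
have nkl : z k != z l by rewrite z_eq eq_sym.
have nla : z l != z a by rewrite eq_sym nBR.
by rewrite addrA -(pole_cycle (nBR a k aB kR) nkl nla); ring.
Qed.

(** The diagonal part is absorbed by pole^2 = pole - coupling; the off-diagonal part, averaged over
    the three cyclic relabelings, contributes 1/3 per ordered triple of distinct sites. *)
Lemma three_body B : \sum_(a in B) Spole B a ^+ 2 + \sum_(a in B) Scoupling B a =
  #|B|%:R * (#|B|%:R - 1) / 2 + #|B|%:R * (#|B|%:R - 1) * (#|B|%:R - 2) / 3.
Proof.
rewrite -sum_sum_pole -big_split /=; apply/eqP; rewrite addrC -subr_eq -sumrB; apply/eqP.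
set n := #|B|%:R.
(* Only y = w must be excluded by hand; the poles already vanish when x meets y or w. *)
pose f (x y w : 'I_N) := (y != w)%:R * (pole (z x) (z y) * pole (z x) (z w)).
set S := LHS.
have e1 : S = \sum_(x in B) \sum_(y in B) \sum_(w in B) f x y w.
  apply: eq_bigr => x xB; rewrite expr2 /pole_sum /coupling_sum mulr_suml -big_split -sumrB /=.
  apply: eq_bigr => y yB; rewrite mulr_sumr.
  rewrite [in LHS](bigD1 y) //= [in RHS](bigD1 y) //= {1}/f eqxx mul0r add0r -expr2 pole_sqr.
  rewrite (eq_bigr (f x y)) => [|w /andP[_ wy]]; last by rewrite /f eq_sym wy mul1r.
  by ring.
have e2 : S = \sum_(x in B) \sum_(y in B) \sum_(w in B) f y w x.
  rewrite e1 [in RHS]exchange_big; apply: eq_bigr => x _ /=.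
  by rewrite exchange_big.
have e3 : S = \sum_(x in B) \sum_(y in B) \sum_(w in B) f w x y.
  by rewrite e2 [in RHS]exchange_big; apply: eq_bigr => x _ /=; rewrite exchange_big.
have e : S + S + S = n * (n - 1) * (n - 2).
  rewrite {1}e1 {1}e2 e3 -!big_split /=.
  rewrite (eq_bigr (fun=> (n - 1) * (n - 2))); first by rewrite sum_card mulrA.
  move=> x xB; rewrite -!big_split /= (big_setD1 x xB) /= -!big_split /= big1 => [|w wB].
    rewrite add0r (eq_bigr (fun=> n - 2)) => [|y].
      by rewrite sum_card cardD1R.
    rewrite in_setD1 => /andP[yx yB]; rewrite -!big_split /=.
    rewrite (big_setD1 x xB) /= (big_setD1 y) ?in_setD1 ?yx //= .
    rewrite /f !eqxx !pole_diag !(mul0r, mulr0) !add0r.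
    rewrite (eq_bigr (fun=> 1)) => [|w]; last first.
      rewrite !in_setD1 => /andP[wy /andP[wx wB]].
      rewrite (eq_sym y w) wy wx (eq_sym x y) yx !mul1r.
      have := @pole_cycle _ (z x) (z y) (z w); rewrite !z_eq (eq_sym x y) (eq_sym y w).
      by move=> /(_ yx wy wx) <-; ring.
    by rewrite sum_card mulr1 cardD1R ?in_setD1 ?yx // cardD1R // /n; ring.
  rewrite /f !pole_diag !(mul0r, mulr0) !add0r.
  by rewrite eqxx /= !(mul0r, mulr0, addr0).
have -> : S = (S + S + S) / 3 by field.
by rewrite e.
Qed.
End ManyBody.

(** * The total exchange sum in a fixed configuration *)

Section Exchange.
Variables (F : numFieldType) (N : nat) (om : F).
Hypothesis om_prim : N.-primitive_root om.
Variables (m n : nat) (B R G : {set 'I_N}).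
Hypothesis Nm : N = (3 * m + 2)%N.
Hypothesis GE : forall u, u \in G = (u \notin B :|: R).
Hypothesis dBR : [disjoint B & R].
Hypotheses (cB : #|B| = m) (cR : #|R| = m.+1) (cG : #|G| = m.+1).

Notation z := (@pt F N om).
Notation phi := (root_coef om).
Notation Spole := (pole_sum om).
Notation Scoupling := (coupling_sum om).
Notation amp0 := (ground_amp om).
Notation amp := (amplitude om).
Notation c0 := (coupling_total F N).
Notation kp a b := (coupling (z a) (z b)).

Let RE u : u \in R = (u \notin B :|: G).
Proof.
rewrite in_setU GE in_setU; case uB: (u \in B); rewrite /= ?negbK //.
exact: disjointFr dBR uB.
Qed.

Let dBG : [disjoint B & G].
Proof. by apply/pred0P => u /=; rewrite GE in_setU; case: (u \in B). Qed.

Let sum_split (f : 'I_N -> F) :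
  \sum_u f u = \sum_(u in B) f u + \sum_(u in R) f u + \sum_(u in G) f u.
Proof.
rewrite (bigID (fun u => u \in B :|: R)) /=; congr (_ + _).
  by rewrite -bigU //=; apply: eq_bigl => u; rewrite in_setU.
by apply: eq_bigl => u; rewrite GE.
Qed.

Let pole_sum_split a : Spole G a = (N%:R - 1) / 2 - Spole B a - Spole R a.
Proof. by rewrite -(sum_pole om_prim a) sum_split /pole_sum; ring. Qed.

Let coupling_sum_split a : Scoupling G a = c0 - Scoupling B a - Scoupling R a.
Proof. by rewrite -(sum_coupling om_prim a) sum_split /coupling_sum; ring. Qed.

Let sum_coupling_sum_sym (A C : {set 'I_N}) : \sum_(a in A) Scoupling C a = \sum_(a in C) Scoupling A a.
Proof.
rewrite /coupling_sum exchange_big; apply: eq_bigr => a _; apply: eq_bigr => b _; exact: couplingC.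
Qed.

(** The contribution of a blue particle hopping past itself and one other color. [S] and [K] are the
    sums for that color: red in a blue-green exchange, green in a blue-red one. *)
Let blue_term (S K : 'I_N -> F) a : F :=
  let A := 1 + 2 * Spole B a + S a in
  (c0 + (A ^+ 2 + (2 * Scoupling B a + K a) - N%:R * A) / 2) * phi n B
  + (2 * A + 1 - N%:R) / 2 * - (z a * phi n (B :\ a)).

Let red_term k : F :=
  let A := 1 + 2 * Spole R k + Spole B k in
  c0 + (A ^+ 2 + (2 * Scoupling R k + Scoupling B k) - N%:R * A) / 2.

Let hop_bg : \sum_(a in B) \sum_(u in G) kp a u * amp n (u |: B :\ a) R =
  amp0 B R * \sum_(a in B) blue_term (Spole R) (Scoupling R) a.
Proof.
rewrite mulr_sumr; apply: eq_bigr => a aB.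
rewrite (eq_bigl _ _ GE) amplitude_hop //; last by rewrite cB cR Nm; lia.
by rewrite /blue_term; field.
Qed.

(** Describing the state by its blue and green sets makes the red sites the empty ones. A blue-red
    exchange leaves the green set fixed, so the same sign from [ground_amp_swap] appears before and
    after the exchange. *)
Let hop_br : \sum_(a in B) \sum_(k in R) kp a k * amp n (k |: B :\ a) (a |: R :\ k) =
  amp0 B R * \sum_(a in B) blue_term (Spole G) (Scoupling G) a.
Proof.
have e : amp0 B R = (-1) ^+ m.+1 * amp0 B G.
  by rewrite (ground_amp_swap om_prim GE dBR) ?cG // cR mulrA -exprD -signr_odd oddD addbb mul1r.
rewrite mulr_sumr; apply: eq_bigr => a aB.
have aR : a \notin R by rewrite (disjointFr dBR aB).
transitivity ((-1) ^+ m.+1 * \sum_(k | k \notin B :|: G) kp a k * amp n (k |: B :\ a) G).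
  rewrite mulr_sumr (eq_bigl _ _ RE); apply: eq_bigr => k; rewrite -RE => kR.
  have kB : k \notin B by rewrite (disjointFl dBR kR).
  have ka : k != a by apply: contraNneq aR => <-.
  have cR' : #|a |: R :\ k| = m.+1.
    by rewrite cardsU1 in_setD1 (negPf aR) andbF -cR [in RHS](cardsD1 k) kR.
  rewrite /amplitude (@ground_amp_swap _ _ _ om_prim (k |: B :\ a) G (a |: R :\ k)).
  - by rewrite cG; ring.
  - move=> u; rewrite !in_setU !in_set1 !in_setD1 GE in_setU.
    have [->|ua] := eqVneq u a; first by rewrite aB eq_sym (negPf ka).
    have [->|uk] := eqVneq u k; rewrite //=.
    case uB: (u \in B); rewrite /= ?negbK //; exact: disjointFr dBR uB.
  - apply/pred0P => u /=; rewrite !in_setU !in_set1 !in_setD1 GE in_setU.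
    have [->|uk] := eqVneq u k; first by rewrite kR orbT.
    by case: (u \in B); rewrite /= ?andbF.
  - by rewrite cG.
rewrite amplitude_hop //; last by rewrite cB cG Nm; lia.
by rewrite e /blue_term; field.
Qed.

Let hop_rg : \sum_(k in R) \sum_(u in G) kp k u * amp n B (u |: R :\ k) =
  amp n B R * \sum_(k in R) red_term k.
Proof.
rewrite mulr_sumr; apply: eq_bigr => k kR.
rewrite (eq_bigr (fun u => phi n B * (kp k u * amp0 B (u |: R :\ k)))); last first.
  by move=> u _; rewrite /amplitude mulrCA.
rewrite -mulr_sumr (eq_bigl _ _ GE) ground_amp_hop //; last by rewrite cB cR Nm; lia.
by rewrite /red_term /amplitude; ring.
Qed.

(** Unlike pairs enter once; same-color pairs act trivially and enter as half their ordered sum. The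
    pieces that depend on the configuration must cancel, leaving a multiple of the amplitude. *)
Lemma exchange_total :
  \sum_(a in B) \sum_(u in G) kp a u * amp n (u |: B :\ a) R +
  \sum_(a in B) \sum_(k in R) kp a k * amp n (k |: B :\ a) (a |: R :\ k) +
  \sum_(k in R) \sum_(u in G) kp k u * amp n B (u |: R :\ k) +
  (\sum_(a in B) Scoupling B a + \sum_(k in R) Scoupling R k + \sum_(u in G) Scoupling G u) / 2
    * amp n B R =
  (N%:R * c0 / 6 - (N%:R ^+ 3 + N%:R + 2) / 36 + 3 / 2 * (m%:R - n%:R) * n%:R)
    * amp n B R.
Proof.
rewrite hop_bg hop_br hop_rg.
set q1 := \sum_(a in B) Spole B a ^+ 2.
pose q2 := \sum_(a in B) Spole B a * Spole R a.
set p1 := \sum_(k in R) Spole R k ^+ 2.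
pose p2 := \sum_(k in R) Spole R k * Spole B k.
pose q3 := \sum_(a in B) Spole R a ^+ 2.
pose p3 := \sum_(k in R) Spole B k ^+ 2.
pose rho := \sum_(a in B) Spole R a.
pose kBB := \sum_(a in B) Scoupling B a; pose kRR := \sum_(a in R) Scoupling R a.
pose kBR := \sum_(a in B) Scoupling R a.
have x1 : q1 + kBB = m%:R * (m%:R - 1) / 2 + m%:R * (m%:R - 1) * (m%:R - 2) / 3.
  by rewrite -cB /q1 /kBB three_body.
have x2 : p1 + kRR = m.+1%:R * (m.+1%:R - 1) / 2 + m.+1%:R * (m.+1%:R - 1) * (m.+1%:R - 2) / 3.
  by rewrite -cR /p1 /kRR three_body.
have x3 : q3 + kBR - rho + 2 * p2 = m%:R * m.+1%:R * (m.+1%:R - 1).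
  by rewrite -cR -cB -(three_body_cross om_prim dBR) sumrB big_split.
have x4 : p3 + kBR - (m%:R * m.+1%:R - rho) + 2 * q2 = m%:R * m.+1%:R * (m%:R - 1).
  rewrite [m%:R * m.+1%:R * _]mulrAC [m%:R * _ * _]mulrC mulrA -cR -cB.
  rewrite -(@three_body_cross _ _ _ om_prim R B) 1?disjoint_sym // sumrB big_split.
  by rewrite -(sum_cross_pole om_prim dBR) /kBR (sum_coupling_sum_sym B R).
have sB : \sum_(a in B) Spole B a = m%:R * (m%:R - 1) / 2.
  by rewrite (sum_sum_pole om_prim) cB.
have sR : \sum_(a in R) Spole R a = m.+1%:R * (m.+1%:R - 1) / 2.
  by rewrite (sum_sum_pole om_prim) cR.
have sRB : \sum_(k in R) Spole B k = m%:R * m.+1%:R - rho.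
  by rewrite (sum_cross_pole om_prim dBR) cB cR.
have kBG : \sum_(u in G) Scoupling B u = m%:R * c0 - kBB - kBR.
  rewrite sum_coupling_sum_sym (eq_bigr _ (fun a _ => coupling_sum_split a)) !sumrB sumr_const cB.
  by rewrite mulr_natl.
have kRG : \sum_(u in G) Scoupling R u = m.+1%:R * c0 - kBR - kRR.
  rewrite sum_coupling_sum_sym (eq_bigr _ (fun a _ => coupling_sum_split a)) !sumrB sumr_const cR.
  by rewrite mulr_natl /kBR (sum_coupling_sum_sym B R).
have kGG : \sum_(u in G) Scoupling G u = m.+1%:R * c0 - (m%:R * c0 - kBB - kBR)
     - (m.+1%:R * c0 - kBR - kRR).
  rewrite -kBG -kRG (eq_bigr _ (fun a _ => coupling_sum_split a)) !sumrB sumr_const cG.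
  by rewrite mulr_natl.
pose psi := \sum_(a in B) - (z a * phi n (B :\ a)).
pose spsi := \sum_(a in B) Spole B a * - (z a * phi n (B :\ a)).
(* Together these two turn the first-order terms [(3 + h - N) psi + 3 spsi] of [e1] into 3/2 (m - n)
   n [phi n B], as N = 3m + 2. *)
have ePsi : psi = (m%:R - n%:R) * phi n B by rewrite /psi sum_root_coef_setD1 cB.
have eSpsi : spsi = (m%:R * (m%:R - 1) - n%:R * (n%:R - 1)) / 2 * phi n B.
  by rewrite /spsi (sum_pole_sum_root_coef_setD1 om_prim) cB.
have NR : N%:R = 3 * m%:R + 2 :> F by rewrite Nm natrD natrM.
pose h : F := (N%:R - 1) / 2.
have e1 : \sum_(a in B) blue_term (Spole R) (Scoupling R) a +
   \sum_(a in B) blue_term (Spole G) (Scoupling G) a =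
   phi n B * (m%:R * (2 * c0 + (1 + (1 + h) ^+ 2 + c0 - N%:R * (2 + h)) / 2)
     + (5 * q1 + 2 * q3 + 2 * q2 + (6 + 2 * h - 3 * N%:R) * \sum_(a in B) Spole B a
        - 2 * h * rho + 3 * kBB) / 2)
   + (3 + h - N%:R) * psi + 3 * spsi.
  rewrite -cB mulr_natl -sumr_const /q1 /q2 /q3 /rho /kBB /psi /spsi.
  rewrite !mulr_sumr -!big_split /= -sumrB -!big_split /= mulr_suml -!big_split /=.
  rewrite mulr_sumr -!big_split /=; apply: eq_bigr => a _.
  by rewrite /blue_term pole_sum_split coupling_sum_split -/h; field.
have e2 : \sum_(k in R) red_term k = m.+1%:R * (c0 + (1 - N%:R) / 2)
   + (4 * p1 + p3 + 4 * p2 + (4 - 2 * N%:R) * \sum_(k in R) Spole R k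
      + (2 - N%:R) * \sum_(k in R) Spole B k + 2 * kRR + \sum_(k in R) Scoupling B k) / 2.
  rewrite -cR mulr_natl -sumr_const /p1 /p2 /p3 /kRR.
  rewrite !mulr_sumr -!big_split /= mulr_suml -!big_split /=; apply: eq_bigr => k _.
  by rewrite /red_term; field.
(* The identities [x1] to [x4] eliminate [q1], [p1], [p2] and [q2]; all remaining unknown sums then
   cancel identically. *)
have y1 := canRL (addrK _) x1; have y2 := canRL (addrK _) x2.
have y3 : p2 = (m%:R * m.+1%:R * (m.+1%:R - 1) - (q3 + kBR - rho)) / 2.
  by rewrite -x3; field.
have y4 : q2 = (m%:R * m.+1%:R * (m%:R - 1) - (p3 + kBR - (m%:R * m.+1%:R - rho))) / 2.
  by rewrite -x4; field.
rewrite -mulrDr e1 /amplitude e2 kGG ePsi eSpsi sB sR sRB (sum_coupling_sum_sym R B) -/kBR -/kBB -/kRR y1 y2 y3 y4.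
rewrite /h /coupling_total -natr1 NR.
by field.
Qed.

End Exchange.

(** * Color configurations and their exchanges *)

Definition color_set N (c : config N) (s : color) : {set 'I_N} := [set a | c a == s].

Definition exchange N (c : config N) (a b : 'I_N) : config N :=
  [ffun x => c (tperm a b x)].

Lemma color_cases (s : color) : [|| s == blue, s == red | s == green].
Proof. by case: s => [[|[|[|]]]]. Qed.

Lemma sum_color (V : zmodType) (f : color -> V) :
  \sum_s f s = f blue + f red + f green.
Proof.
rewrite !big_ord_recl big_ord0 addr0 -addrA.
by congr (f _ + (f _ + f _)); apply: val_inj.
Qed.

Section Config.
Variable N : nat.
Implicit Types (c : config N) (a b u : 'I_N) (s t : color).

Lemma in_color_set c s a : (a \in color_set c s) = (c a == s).
Proof. by rewrite inE. Qed.

Lemma xchC c a b : exchange c a b = exchange c b a.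
Proof. by apply/ffunP=> x; rewrite !ffunE tpermC. Qed.

Lemma exchange_same c a b : c a = c b -> exchange c a b = c.
Proof. by move=> h; apply/ffunP=> x; rewrite ffunE; case: tpermP => [->|->|]. Qed.

Lemma card_color_set_exchange c a b s : #|color_set (exchange c a b) s| = #|color_set c s|.
Proof.
rewrite -(card_preimset (color_set c s) (@perm_inj _ (tperm a b))).
by apply: eq_card => x; rewrite !inE ffunE.
Qed.

Lemma color_set_exchange c a b s t : s != t -> c a = s -> c b = t ->
  color_set (exchange c a b) s = b |: color_set c s :\ a.
Proof.
move=> st ca cb; apply/setP=> x; rewrite !inE ffunE.
case: tpermP => [->|->|/eqP xa /eqP xb]; first by rewrite cb eqxx andFb orbF eq_sym (negPf st); apply/esym/eqP => ab; move: st; rewrite -ca -cb ab eqxx.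
  by rewrite ca !eqxx.
by rewrite (negPf xb) xa.
Qed.

Lemma color_set_exchange_other c a b s : c a != s -> c b != s -> color_set (exchange c a b) s = color_set c s.
Proof.
move=> ca cb; apply/setP=> x; rewrite !inE ffunE.
by case: tpermP => [->|->|] //; rewrite (negPf ca) (negPf cb).
Qed.

Lemma color_set_green c u :
  (u \in color_set c green) = (u \notin color_set c blue :|: color_set c red).
Proof. by rewrite !inE; move: (color_cases (c u)) => /or3P[] /eqP->. Qed.

Lemma disjoint_color_set c s t : s != t -> [disjoint color_set c s & color_set c t].
Proof.
by move=> st; apply/pred0P => u; rewrite /= !inE; case: eqP => //= ->; exact: negPf.
Qed.

Lemma sum_color_set (V : zmodType) c (f : 'I_N -> V) :
  \sum_u f u = \sum_(u in color_set c blue) f u + \sum_(u in color_set c red) f u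
     + \sum_(u in color_set c green) f u.
Proof.
rewrite (partition_big c predT) //= sum_color.
by congr (_ + _ + _); apply: eq_bigl => u; rewrite inE.
Qed.

Lemma card_color_set c : (#|color_set c blue| + #|color_set c red| + #|color_set c green| = N)%N.
Proof.
have dBR := disjoint_color_set c (isT : blue != red).
have -> : color_set c green = ~: (color_set c blue :|: color_set c red).
  by apply/setP=> u; rewrite color_set_green in_setC.
have := cardsC (color_set c blue :|: color_set c red); rewrite card_ord cardsU.
by rewrite (disjoint_setI0 dBR) cards0 subn0.
Qed.

Lemma sum_lt_sym (F : numFieldType) (f : 'I_N -> 'I_N -> F) :
  (forall a b, f a b = f b a) -> (forall a, f a a = 0) ->
  \sum_(a < N) \sum_(b < N | (a < b)%N) f a b = (\sum_a \sum_b f a b) / 2.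
Proof.
move=> fC f0; set S := LHS.
have e : \sum_a \sum_b f a b = S + S.
  have -> : S + S = S + \sum_(b < N) \sum_(a < N | (a < b)%N) f a b.
    by congr (_ + _); rewrite /S (exchange_big_dep predT).
  rewrite /S -big_split; apply: eq_bigr => a _ /=.
  rewrite (bigID (fun b : 'I_N => (a < b)%N)) /=; congr (_ + _).
  rewrite [LHS](bigD1 a) ?ltnn //= f0 add0r.
  by apply: eq_big => [b|b _]; rewrite // -leqNgt ltn_neqAle andbC.
by rewrite e; field.
Qed.

End Config.

(** * The eigenvalue equation for the transposition sum *)

Section WaveFunction.
Variables (F : numFieldType) (N : nat) (om : F).
Hypothesis om_prim : N.-primitive_root om.
Variables (m n : nat).
Hypothesis Nm : N = (3 * m + 2)%N.
Implicit Types (c : config N) (a b u : 'I_N).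

Definition valid c := (#|color_set c blue| == m) && (#|color_set c red| == m.+1).

Definition wave c : F :=
  if valid c then amplitude om n (color_set c blue) (color_set c red) else 0.

Lemma valid_exchange c a b : valid (exchange c a b) = valid c.
Proof. by rewrite /valid !card_color_set_exchange. Qed.

(** The first term is the constant that the -1/27 in the Hamiltonian removes: one third of the sum
    of the coupling over pairs. *)
Definition exchange_eigenvalue : F := N%:R * coupling_total F N / 6
  - (N%:R ^+ 3 + N%:R + 2) / 36 + 3 / 2 * (m%:R - n%:R) * n%:R.

(** Outside the sector with m blue and m+1 red sites both sides vanish, because exchanges preserve
    the color counts. Inside, the ordered double sum splits by colors into the terms of
    [exchange_total]. *)
Lemma wave_exchange c :
  (\sum_a \sum_b coupling (pt om a) (pt om b) * wave (exchange c a b)) / 2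
    = exchange_eigenvalue * wave c.
Proof.
case vc: (valid c); last first.
  rewrite /wave vc mulr0 big1 ?mul0r // => a _; rewrite big1 // => b _.
  by rewrite valid_exchange vc mulr0.
set B := color_set c blue; set R := color_set c red; set G := color_set c green.
have /andP[/eqP cB /eqP cR] := vc.
have cG : #|G| = m.+1 by have := card_color_set c; rewrite cB cR -/G => h; lia.
have cBE a : a \in B -> c a = blue by rewrite inE => /eqP.
have cRE a : a \in R -> c a = red by rewrite inE => /eqP.
have cGE a : a \in G -> c a = green by rewrite inE => /eqP.
pose T a b := coupling (pt om a) (pt om b) * wave (exchange c a b).
have TC a b : T a b = T b a by rewrite /T couplingC xchC.
have same (A : {set 'I_N}) s : (forall a, a \in A -> c a = s) ->
    \sum_(a in A) \sum_(b in A) T a b = (\sum_(a in A) coupling_sum om A a) * wave c.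
  move=> h; rewrite mulr_suml; apply: eq_bigr => a aA; rewrite mulr_suml.
  by apply: eq_bigr => b bA; rewrite /T exchange_same // !h.
have TX (A C : {set 'I_N}) :
    \sum_(a in A) \sum_(b in C) T a b = \sum_(a in C) \sum_(b in A) T a b.
  by rewrite exchange_big; apply: eq_bigr => a _; apply: eq_bigr => b _.
have := @exchange_total F N om om_prim m n B R G Nm (@color_set_green _ c)
  (disjoint_color_set c (isT : blue != red)) cB cR cG.
have -> : amplitude om n B R = wave c by rewrite /wave vc.
have bg : \sum_(a in B) \sum_(u in G) coupling (pt om a) (pt om u) * amplitude om n (u |: B :\ a) R =
    \sum_(a in B) \sum_(u in G) T a u.
  apply: eq_bigr => a /cBE ca; apply: eq_bigr => u /cGE cu.
  rewrite /T /wave valid_exchange vc (@color_set_exchange _ _ _ _ blue green) //.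
  by rewrite color_set_exchange_other ?ca ?cu.
have br : \sum_(a in B) \sum_(k in R) coupling (pt om a) (pt om k) *
     amplitude om n (k |: B :\ a) (a |: R :\ k) = \sum_(a in B) \sum_(k in R) T a k.
  apply: eq_bigr => a /cBE ca; apply: eq_bigr => k /cRE ck.
  rewrite /T /wave valid_exchange vc (@color_set_exchange _ _ _ _ blue red) //.
  by rewrite xchC (@color_set_exchange _ _ _ _ red blue).
have rg : \sum_(k in R) \sum_(u in G) coupling (pt om k) (pt om u) * amplitude om n B (u |: R :\ k) =
    \sum_(k in R) \sum_(u in G) T k u.
  apply: eq_bigr => k /cRE ck; apply: eq_bigr => u /cGE cu.
  rewrite /T /wave valid_exchange vc (@color_set_exchange _ _ _ _ red green) //.
  by rewrite color_set_exchange_other ?ck ?cu.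
rewrite bg br rg -/(exchange_eigenvalue) => <-.
rewrite (sum_color_set c) -/B -/R -/G.
have split_in (A : {set 'I_N}) : \sum_(a in A) \sum_b T a b =
   \sum_(a in A) \sum_(b in B) T a b + \sum_(a in A) \sum_(b in R) T a b
   + \sum_(a in A) \sum_(b in G) T a b.
  by rewrite -!big_split; apply: eq_bigr => a _ /=; rewrite (sum_color_set c).
rewrite -/(T _ _) !split_in (same _ _ cBE) (same _ _ cRE) (same _ _ cGE).
by rewrite (TX R B) (TX G B) (TX G R); field.
Qed.

End WaveFunction.

(** * Total spin operators and the construction of the 3-bar *)

Section SpinAlgebra.
Variables (R : realType) (N : nat).
Implicit Types (psi phi : state R N) (c d : config N) (s t u v : color) (a b : 'I_N).

Lemma recolor_at c a t : recolor c a t a = t.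
Proof. by rewrite ffunE eqxx. Qed.

Lemma recolor_off c a t b : b != a -> recolor c a t b = c b.
Proof. by rewrite ffunE => /negPf->. Qed.

Lemma recolor_recolor c a s t : recolor (recolor c a s) a t = recolor c a t.
Proof. by apply/ffunP=> b; rewrite !ffunE; case: eqP. Qed.

Lemma recolor_id c a s : c a = s -> recolor c a s = c.
Proof. by move=> <-; apply/ffunP=> b; rewrite ffunE; case: eqP => [->|]. Qed.

Lemma recolorC c a b s t : a != b ->
  recolor (recolor c a s) b t = recolor (recolor c b t) a s.
Proof.
move=> ab; apply/ffunP=> x; rewrite !ffunE.
by case: (eqVneq x b) => [->|//]; rewrite eq_sym (negPf ab).
Qed.

Lemma total_flipE s t psi c :
  total_flip s t psi c = \sum_a (c a == s)%:R * psi (recolor c a t) :> R[i].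
Proof.
rewrite /total_flip sum_ffunE; apply: eq_bigr => a _.
by rewrite ffunE; case: eqP; rewrite ?mul1r ?mul0r.
Qed.

Lemma total_flip_is_linear s t : linear (@total_flip R N s t).
Proof.
move=> k x y; apply/ffunP=> c; rewrite !ffunE !total_flipE.
rewrite (eq_bigr (fun a => k * ((c a == s)%:R * x (recolor c a t)) +
   (c a == s)%:R * y (recolor c a t))); last first.
  by move=> a _; rewrite !ffunE mulrDr mulrCA.
by rewrite big_split -mulr_sumr.
Qed.

HB.instance Definition _ s t := GRing.isLinear.Build R[i] (state R N) (state R N) _
  (@total_flip R N s t) (@total_flip_is_linear s t).

(** The part of a product of two total flips acting on distinct sites; being symmetric in the two
    flips, it drops out of the commutator. *)
Let off s t u v psi c : R[i] := \sum_a \sum_(b | b != a)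
  (c a == s)%:R * (c b == u)%:R * psi (recolor (recolor c a t) b v).

Let off_swap s t u v psi c : off s t u v psi c = off u v s t psi c.
Proof.
rewrite /off (exchange_big_dep predT) //=; apply: eq_bigr => a _.
apply: eq_big => [b|b ba]; first by rewrite eq_sym.
by rewrite recolorC 1?eq_sym // [X in X * _ = _]mulrC.
Qed.

Let total_flip2 s t u v psi c : total_flip s t (total_flip u v psi) c =
  off s t u v psi c + (t == u)%:R * total_flip s v psi c :> R[i].
Proof.
rewrite !total_flipE mulr_sumr -big_split; apply: eq_bigr => a _ /=.
rewrite total_flipE (bigD1 a) //= recolor_at recolor_recolor mulrDr addrC; congr (_ + _).
  by rewrite mulrCA.
by rewrite mulr_sumr; apply: eq_bigr => b ba; rewrite recolor_off // mulrA.
Qed.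

Lemma total_flip_comb s t (k l : R[i]) (x y : state R N) :
  total_flip s t (k *: x + l *: y) = k *: total_flip s t x + l *: total_flip s t y.
Proof. by rewrite linearD /= !linearZ. Qed.

Lemma total_flip_comm s t u v psi :
  total_flip s t (total_flip u v psi) = total_flip u v (total_flip s t psi)
    + (t == u)%:R *: total_flip s v psi - (s == v)%:R *: total_flip u t psi.
Proof.
apply/ffunP=> c; rewrite !ffunE /GRing.scale /= !total_flip2 off_swap (eq_sym v).
by rewrite [in RHS]addrAC addrK.
Qed.

Definition inner phi psi : R[i] := \sum_c Num.conj (phi c : R[i]) * psi c.

Lemma ip_eq0 psi : inner psi psi = 0 -> psi = 0.
Proof.
move=> h; apply/ffunP=> c; rewrite ffunE.
have hc d : true -> 0 <= Num.conj (psi d : R[i]) * psi d.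
  by rewrite mulrC -normCK exprn_ge0.
have /(_ c isT) := psumr_eq0P hc h.
by rewrite mulrC -normCK => /eqP; rewrite expf_eq0 normr_eq0 => /eqP.
Qed.

Lemma ip_total_flip s t phi psi :
  inner phi (total_flip s t psi) = inner (total_flip t s phi) psi.
Proof.
rewrite /inner.
transitivity (\sum_a \sum_(c : config N | c a == s)
    Num.conj (phi c : R[i]) * psi (recolor c a t)).
  rewrite [RHS](exchange_big_dep predT) //=; apply: eq_bigr => c _.
  rewrite total_flipE mulr_sumr [RHS]big_mkcond; apply: eq_bigr => a _.
  by case: eqP; rewrite ?mul1r ?mul0r ?mulr0.
transitivity (\sum_a \sum_(c : config N | c a == t)
    Num.conj (phi (recolor c a s) : R[i]) * psi c); last first.
  rewrite (exchange_big_dep predT) //=; apply: eq_bigr => c _.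
  rewrite total_flipE rmorph_sum mulr_suml big_mkcond; apply: eq_bigr => a _ /=.
  by rewrite rmorphM rmorph_nat; case: eqP; rewrite ?mul1r ?mul0r.
apply: eq_bigr => a _.
rewrite (reindex_onto (fun c => recolor c a s) (fun c => recolor c a t)) /=.
  apply: eq_big => [c|c /andP[_ /eqP cE]]; last by rewrite cE.
  rewrite recolor_at eqxx recolor_recolor.
  by apply/eqP/eqP => [<-|ca]; rewrite ?recolor_at // recolor_id.
by move=> c /eqP ca; rewrite recolor_recolor recolor_id.
Qed.

(** The flips s,t and t,s are adjoint, so the hypothesis makes the norm of [total_flip s t phi]
    zero. *)
Lemma total_flip_kernel s t phi :
  total_flip t s (total_flip s t phi) = 0 -> total_flip s t phi = 0.
Proof.
move=> h; apply: ip_eq0; rewrite ip_total_flip h /inner big1 // => c _.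
by rewrite ffunE rmorph0 mul0r.
Qed.

Section LowestWeight.
Variables (m : nat) (psi : state R N).
Hypotheses (Hgr : total_flip green red psi = 0) (Hgb : total_flip green blue psi = 0).
Hypotheses (Hb : total_flip blue blue psi = m%:R *: psi)
  (Hr : total_flip red red psi = m.+1%:R *: psi)
  (Hg : total_flip green green psi = m.+1%:R *: psi).

(** The commutator of the red-green flips is the difference of the green and red counts, which are
    equal; then positivity applies. *)
Lemma lowest_rg : total_flip red green psi = 0.
Proof.
apply: total_flip_kernel; rewrite total_flip_comm Hgr linear0 add0r !eqxx !scale1r.
by rewrite Hg Hr subrr.
Qed.

Lemma lowest_rb : total_flip red blue psi = 0.
Proof.
have := total_flip_comm red green green blue psi.
by rewrite Hgb lowest_rg !linear0 !scale0r subr0 add0r eqxx scale1r.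
Qed.

(** The minus sign makes the flips act as minus the transposed matrix units. *)
Definition bar_basis u : state R N := if u == blue then psi else - total_flip blue u psi.

Let act0 s t : total_flip s t psi =
  - ((s == blue)%:R *: bar_basis t) + ((s == t)%:R * m.+1%:R) *: psi.
Proof.
have /or3P[] := color_cases s => /eqP->; have /or3P[] := color_cases t => /eqP->;
  rewrite /bar_basis /= ?scale1r ?scale0r ?mul0r ?scale0r ?oppr0 ?mul1r ?opprK ?addr0 ?add0r //.
- by rewrite Hb -natr1 scalerDl scale1r addrC addrK.
- exact: lowest_rb.
- exact: lowest_rg.
Qed.

Let act_diag u : u != blue -> total_flip u u psi = m.+1%:R *: psi.
Proof. by move=> ub; rewrite act0 (negPf ub) eqxx mul1r scale0r oppr0 add0r. Qed.

(** The representation stops after one raising step. Commuting down gives E_ub E_bt psi = delta_ut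
    psi, the difference of the counts being 1; hence E_ub kills E_bu E_bt psi, and positivity
    finishes. *)
Let act2 t u : t != blue -> u != blue -> total_flip blue u (total_flip blue t psi) = 0.
Proof.
move=> tb ub; apply: total_flip_kernel.
have aub : total_flip u blue psi = 0.
  by rewrite act0 (negPf ub) mul0r !scale0r oppr0 add0r.
have e : total_flip u blue (total_flip blue t psi) = (u == t)%:R *: psi.
  rewrite total_flip_comm aub linear0 add0r eqxx scale1r Hb act0 (negPf ub).
  rewrite scale0r oppr0 add0r scalerA -scalerBl -mulrBr -natr1 addrAC subrr add0r.
  by rewrite mulr1.
rewrite total_flip_comm e linearZ eqxx !scale1r.
rewrite (total_flip_comm u u) (total_flip_comm blue blue) (act_diag ub) Hb !linearZ /=.
rewrite (negPf ub) (eq_sym blue t) (negPf tb) eqxx -natr1 !scale0r.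
move: (total_flip blue u psi) (total_flip blue t psi) => x y.
by apply/ffunP=> c; rewrite !ffunE /GRing.scale /=; ring.
Qed.

(** The second term is a multiple of the identity proportional to the trace of the matrix unit,
    hence invisible to traceless matrices. *)
Lemma act_bar_basis s t u : total_flip s t (bar_basis u) =
  - ((s == u)%:R *: bar_basis t) + ((s == t)%:R * m.+1%:R) *: bar_basis u.
Proof.
have [->|ub] := eqVneq u blue; first by rewrite act0 /bar_basis eqxx.
have xu : bar_basis u = - total_flip blue u psi by rewrite /bar_basis (negPf ub).
have au : total_flip s u psi = - ((s == blue)%:R *: bar_basis u) + ((s == u)%:R * m.+1%:R) *: psi.
  exact: act0.
rewrite {1}xu linearN /= total_flip_comm act0 -[- (_ *: bar_basis t)]scaleNr total_flip_comb.
have -> : total_flip blue u (bar_basis t) = - ((t == blue)%:R *: bar_basis u).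
  have [->|tb] := eqVneq t blue; first by rewrite xu scale1r opprK /bar_basis eqxx.
  rewrite /bar_basis (negPf tb).
  by rewrite linearN /= act2 // scale0r oppr0.
have [->|tb] := eqVneq t blue; last first.
  rewrite !scale0r {1}/bar_basis (negPf tb) xu.
  move: (total_flip blue u psi) (total_flip blue t psi) => x y.
  by apply/ffunP=> c; rewrite !ffunE /GRing.scale /=; ring.
rewrite Hb !scale1r au -[total_flip blue u psi]opprK -xu /bar_basis eqxx -/(bar_basis u) -natr1.
move: (bar_basis u) => x; apply/ffunP=> c; rewrite !ffunE /GRing.scale /=; ring.
Qed.

Definition rep3bar (v : 'cV[R[i]]_3) : state R N := \sum_u v u 0 *: bar_basis u.

Lemma rep3bar_is_linear : linear rep3bar.
Proof.
move=> k x y; rewrite /rep3bar scaler_sumr -big_split; apply: eq_bigr => u _ /=.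
by rewrite !mxE scalerDl scalerA.
Qed.

HB.instance Definition _ := GRing.isLinear.Build R[i] 'cV[R[i]]_3 (state R N) _
  rep3bar rep3bar_is_linear.

Let total_flip_rep s t (v : 'cV[R[i]]_3) : total_flip s t (rep3bar v) =
  - (v s 0 *: bar_basis t) + ((s == t)%:R * m.+1%:R) *: rep3bar v.
Proof.
rewrite /rep3bar linear_sum scaler_sumr (bigD1 s) //= [X in _ = _ + X](bigD1 s) //= addrA.
congr (_ + _); last first.
  apply: eq_bigr => u us; rewrite linearZ /= act_bar_basis eq_sym (negPf us) scale0r oppr0 add0r.
  by rewrite !scalerA mulrC.
by rewrite linearZ /= act_bar_basis eqxx scale1r scalerDr scalerN !scalerA mulrC.
Qed.

(** The module is the span of [bar_basis]: each of these vectors is psi or a flip of psi, which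
    gives minimality. *)
Lemma lowest_transforms : psi != 0 -> transforms_as_3bar psi.
Proof.
move=> psi0; pose f : 'Hom('cV[R[i]]_3, state R N) := linfun rep3bar.
have fE (v : 'cV[R[i]]_3) : f v = rep3bar v by rewrite lfunE.
have fd u : f (delta_mx u 0) = bar_basis u.
  rewrite fE /rep3bar (bigD1 u) //= mxE !eqxx scale1r big1 ?addr0 // => t tu.
  by rewrite mxE (negPf tu) scale0r.
exists (limg f); split.
  split.
  - move=> s t phi st /memv_imgP[v _ ->]; rewrite fE total_flip_rep (negPf st) mul0r scale0r addr0.
    by rewrite -fd -linearZ -linearN memv_img ?memvf.
  - have -> : psi = f (delta_mx blue 0) by rewrite fd /bar_basis eqxx.
    by rewrite memv_img ?memvf.
  move=> W WI pW; apply/subvP=> _ /memv_imgP[v _ ->]; rewrite fE.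
  apply: memv_suml => u _; apply: memvZ; rewrite /bar_basis; case: eqP => [_|/eqP ub] //.
  by rewrite memvN; apply: WI; rewrite // eq_sym.
exists f; split=> //.
  apply/eqP/lker0P; suff h (v : 'cV[R[i]]_3) : f v = 0 -> v = 0.
    by move=> x y e; apply/eqP; rewrite -subr_eq0; apply/eqP/h; rewrite linearB /= e subrr.
  move=> v0.
  (* The flip from s to blue maps the image of v to -v_s psi, so each coordinate with s != blue
     vanishes; the blue one is then the coefficient of psi. *)
  have v_off s : s != blue -> v s 0 = 0.
    move=> sb; have := total_flip_rep s blue v; rewrite -fE v0 !linear0.
    rewrite addr0 /bar_basis eqxx => /esym/eqP; rewrite oppr_eq0 scaler_eq0.
    by rewrite (negPf psi0) orbF => /eqP.
  have vb : v blue 0 = 0.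
    move: v0; rewrite fE /rep3bar (bigD1 blue) //= big1 => [|u ub]; last by rewrite v_off // scale0r.
    rewrite addr0 /bar_basis eqxx => /eqP; rewrite scaler_eq0 (negPf psi0) orbF.
    by move=> /eqP.
  apply/matrixP=> s j; rewrite ord1 mxE; have [->|sb] := eqVneq s blue => //.
  exact: v_off.
move=> X v trX; rewrite !fE /total_spin.
rewrite (eq_bigr (fun s => \sum_t (- ((X s t * v s 0) *: bar_basis t)
    + (X s t * ((s == t)%:R * m.+1%:R)) *: rep3bar v))); last first.
  move=> s _; apply: eq_bigr => t _.
  by rewrite total_flip_rep scalerDr scalerN !scalerA.
rewrite (eq_bigr (fun s => \sum_t - ((X s t * v s 0) *: bar_basis t)
    + (X s s * m.+1%:R) *: rep3bar v)); last first.
  move=> s _; rewrite big_split -scaler_suml; congr (_ + _ *: _).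
  rewrite (bigD1 s) //= eqxx mul1r big1 ?addr0 // => t ts.
  by rewrite eq_sym (negPf ts) mul0r mulr0.
rewrite big_split /= -scaler_suml -mulr_suml -/(mxtrace X) trX mul0r scale0r addr0.
rewrite exchange_big; apply: eq_bigr => t _ /=.
rewrite sumrN -scaler_suml -scaleNr; congr (_ *: _).
rewrite /conj_rep mulNmx !mxE; congr (- _); apply: eq_bigr => s _.
by rewrite mxE.
Qed.

End LowestWeight.
End SpinAlgebra.

(** * The sites as powers of a primitive root of unity *)

Section Eta.
Variables (R : realType) (N : nat).
Hypothesis N_gt0 : (0 < N)%N.

Let N0 : N%:R != 0 :> R. Proof. by rewrite pnatr_eq0 -lt0n. Qed.

Lemma cis_exp (t : R) k : (cos t +i* sin t) ^+ k = cos (t * k%:R) +i* sin (t * k%:R).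
Proof.
elim: k => [|k IH]; first by rewrite expr0 mulr0 cos0 sin0.
rewrite exprS IH -natr1 mulrDr mulr1 [t * _ + t]addrC cosD sinD.
by apply/eqP; rewrite eq_complex /=; apply/andP; split; apply/eqP; ring.
Qed.

Lemma eta_exp k : eta R N k = eta R N 1 ^+ k.
Proof.
rewrite /eta /= cis_exp; set t := _ / _; set u := (X in _ = cos X +i* _).
by have -> : t = u by rewrite /t /u; field.
Qed.

Lemma etaN : eta R N 1 ^+ N = 1.
Proof.
rewrite -eta_exp /eta /= mulfK //; have -> : 2 * pi = pi *+ 2 :> R by rewrite mulr_natl.
by rewrite cos2pi sin2pi.
Qed.

Lemma cos_lt1 (x : R) : 0 < x < pi *+ 2 -> cos x != 1.
Proof.
move=> /andP[x0 x2]; have hs : 0 < sin (x / 2).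
  apply: sin_gt0_pi; rewrite divr_gt0 //= ltr_pdivrMr // mulr_natr //.
have -> : x = x / 2 + x / 2 by field.
rewrite cosD -!expr2 cos2sin2; apply/eqP => h.
have : sin (x / 2) ^+ 2 > 0 by rewrite exprn_gt0.
by move: h; set s := sin _ ^+ 2; lra.
Qed.

(** If the order were a proper divisor k of N, the angle 2 pi k/N would lie strictly between 0 and 2
    pi with cosine 1. *)
Lemma eta_prim : N.-primitive_root (eta R N 1).
Proof.
have [k kN kp] := prim_order_exists N_gt0 etaN.
have hk1 := prim_expr_order kN.
have k0 : (0 < k)%N := prim_order_gt0 kN.
move: hk1; rewrite -eta_exp /eta /= => -[hc _].
have [e|kN'] := eqVneq N k; first by rewrite {1}e.
have klt : (k < N)%N by rewrite ltn_neqAle eq_sym kN' dvdn_leq.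
have Np : 0 < N%:R :> R by rewrite ltr0n.
have : 0 < (2 * pi * k%:R / N%:R : R) < pi *+ 2.
  rewrite divr_gt0 ?mulr_gt0 ?pi_gt0 ?ltr0n //= ltr_pdivrMr // -[pi *+ 2]mulr_natl.
  by rewrite ltr_pM2l ?mulr_gt0 ?pi_gt0 // ltr_nat.
by move/cos_lt1; rewrite hc eqxx.
Qed.

Lemma siteE (a : 'I_N) : site R a = pt (eta R N 1) a.
Proof. by rewrite /site eta_exp. Qed.

Lemma conj_eta k : Num.conj (eta R N k) = (eta R N k)^-1.
Proof.
have h : Num.conj (eta R N k) * eta R N k = 1.
  rewrite mulrC -normCK /eta; set t := _ / _.
  by rewrite normc_def /= cos2Dsin2 sqrtr1 expr1n.
have e0 : eta R N k != 0 by apply: contra_eq_neq h => ->; rewrite mulr0 eq_sym oner_eq0.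
by apply: (mulIf e0); rewrite h mulVf.
Qed.

(** Conjugation is inversion on the unit circle. At equal sites both sides are 0 by the convention
    for the inverse of 0. *)
Lemma norm_site (a b : 'I_N) :
  (`|site R a - site R b| ^+ 2)^-1 = coupling (site R a) (site R b).
Proof.
have [->|ab] := eqVneq a b; first by rewrite coupling_diag subrr normr0 expr0n invr0.
have nz (c : 'I_N) : site R c != 0 by rewrite siteE pt_neq0 // eta_prim.
have d1 : site R a - site R b != 0.
  by rewrite subr_eq0 !siteE (inj_eq (pt_inj eta_prim)).
have d2 : site R b - site R a != 0 by rewrite -opprB oppr_eq0.
rewrite normCK rmorphB /= !conj_eta -!/(site R _) /coupling /pole.
have d3 : (site R a)^-1 - (site R b)^-1 != 0.
  by rewrite subr_eq0 (inj_eq invr_inj) -subr_eq0.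
have -> : (site R a)^-1 - (site R b)^-1 = (site R b - site R a) / (site R a * site R b).
  by field; rewrite !nz.
by field; rewrite d1 d2 !nz.
Qed.

End Eta.

(** * The Hamiltonian as a sum of site transpositions *)

Section Ham.
Variables (R : realType) (N : nat).
Hypothesis N_gt0 : (0 < N)%N.
Implicit Types (psi : state R N) (c : config N) (a b : 'I_N).

Lemma exchange_recolor c a b : a != b ->
  recolor (recolor c a (c b)) b (c a) = exchange c a b.
Proof.
move=> ab; apply/ffunP=> x; rewrite !ffunE.
by case: tpermP => [->|->|/eqP xa /eqP xb]; rewrite ?eqxx ?(negPf ab) ?(negPf xa) ?(negPf xb).
Qed.

(** Of the nine color pairs, only the one matching the present colors of the two sites survives. *)
Lemma flip_exchange psi c a b : a != b ->
  \sum_(s : color) \sum_(t : color) (flip a s t (flip b t s psi) c : R[i]) = psi (exchange c a b).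
Proof.
move=> ab; rewrite (bigD1 (c a)) //= [X in _ + X]big1 ?addr0 => [|s sa]; last first.
  by rewrite big1 // => t _; rewrite ffunE eq_sym (negPf sa).
have ba : b != a by rewrite eq_sym.
rewrite (bigD1 (c b)) //= [X in _ + X]big1 ?addr0 => [|t tb].
  by rewrite ffunE eqxx ffunE recolor_off // eqxx exchange_recolor.
by rewrite ffunE eqxx ffunE recolor_off // eq_sym (negPf tb).
Qed.

Lemma hamiltonianE psi c : hamiltonian psi c =
  (2 * pi ^+ 2 / N%:R ^+ 2)%:C *
    ((\sum_a \sum_b coupling (site R a) (site R b) * psi (exchange c a b)) / 2
      - N%:R * coupling_total R[i] N / 6 * psi c) :> R[i].
Proof.
rewrite /hamiltonian ffunE /GRing.scale /=; congr (_ * _).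
pose g a b : R[i] := coupling (site R a) (site R b) * (psi (exchange c a b) - psi c / 3).
transitivity (\sum_(a < N) \sum_(b < N | (a < b)%N) g a b).
  rewrite sum_ffunE; apply: eq_bigr => a _; rewrite sum_ffunE; apply: eq_bigr => b ab.
  rewrite sum_ffunE (eq_bigr (fun s => \sum_(t : color) coupling (site R a) (site R b) *
     ((flip a s t (flip b t s psi) c : R[i]) - 27%:R^-1 * psi c))); last first.
    move=> s _; rewrite sum_ffunE; apply: eq_bigr => t _.
    by rewrite norm_site // !ffunE /GRing.scale /=.
  rewrite /g -(@flip_exchange psi c a b); last by rewrite neq_ltn ab.
  under eq_bigr => s _ do rewrite -mulr_sumr sumrB sumr_const card_ord.
  rewrite -mulr_sumr sumrB sumr_const card_ord; congr (_ * (_ - _)).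
  (* Nine color pairs with 1/27 each give 1/3. *)
  by rewrite -mulrnA -[LHS]mulr_natr; field.
have g0 a : g a a = 0 by rewrite /g coupling_diag mul0r.
have gC a b : g a b = g b a by rewrite /g couplingC xchC.
rewrite (sum_lt_sym gC g0).
have -> : \sum_(a < N) \sum_(b < N) g a b =
   (\sum_a \sum_b coupling (site R a) (site R b) * psi (exchange c a b))
     - N%:R * coupling_total R[i] N * (psi c / 3).
  transitivity (\sum_(a < N) ((\sum_b coupling (site R a) (site R b) * psi (exchange c a b))
     - coupling_total R[i] N * (psi c / 3))).
    apply: eq_bigr => a _; rewrite -(sum_coupling (eta_prim R N_gt0) a) mulr_suml -sumrB.
    by apply: eq_bigr => b _; rewrite /g mulrBr !siteE.
  by rewrite sumrB sumr_const card_ord -[_ *+ N]mulr_natl mulrA.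
by field.
Qed.

End Ham.

(** * Increasing listings and the coefficients of the ket *)

Section Listing.
Variable N : nat.

Lemma increasing_lt k (z : {ffun 'I_k -> 'I_N}) : increasing z ->
  forall i j : 'I_k, (i < j)%N -> (z i < z j)%N.
Proof. by rewrite /increasing => /forallP iz i j; have /forallP/(_ j)/implyP := iz i. Qed.

Lemma increasing_inj k (z : {ffun 'I_k -> 'I_N}) : increasing z -> injective z.
Proof.
move=> /increasing_lt iz i j zij.
by case: (ltngtP i j) => [/iz|/iz|/ord_inj//]; rewrite zij ltnn.
Qed.

Let ltI : rel 'I_N := fun a b => (a < b)%N.

Let ltI_trans : transitive ltI.
Proof. by move=> a b c; exact: ltn_trans. Qed.

Let ltI_irr : irreflexive ltI.
Proof. by move=> a; exact: ltnn. Qed.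

Let sorted_enum k (P : pred 'I_k) : sorted (fun a b : 'I_k => a < b)%N (enum P).
Proof.
rewrite /enum_mem; apply: sorted_filter; first by move=> a b c; exact: ltn_trans.
rewrite -enumT; have : sorted ltn (map val (enum 'I_k)) by rewrite val_enum_ord iota_ltn_sorted.
by rewrite sorted_map.
Qed.

Lemma sorted_increasing k (z : {ffun 'I_k -> 'I_N}) :
  increasing z -> sorted ltI (codom z).
Proof.
move=> /increasing_lt iz; rewrite sorted_map.
by apply: sub_sorted (sorted_enum predT) => i j; apply: iz.
Qed.

Lemma increasing_eq k (z z' : {ffun 'I_k -> 'I_N}) :
  increasing z -> increasing z' -> codom z =i codom z' -> z = z'.
Proof.
move=> iz iz' e.
have := irr_sorted_eq ltI_trans ltI_irr (sorted_increasing iz) (sorted_increasing iz') e.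
by move=> /eq_in_map h; apply/ffunP=> i; apply: h; rewrite mem_enum.
Qed.

Lemma increasing_listing (A : {set 'I_N}) k : #|A| = k ->
  exists2 z : {ffun 'I_k -> 'I_N}, increasing z & forall a, (a \in codom z) = (a \in A).
Proof.
move=> <-; exists [ffun i => enum_val i]; last first.
  move=> a; apply/codomP/idP => [[i ->]|aA]; first by rewrite ffunE enum_valP.
  by exists (enum_rank_in aA a); rewrite ffunE enum_rankK_in.
rewrite /increasing; apply/forallP=> i; apply/forallP=> j; apply/implyP=> ij; rewrite !ffunE.
have x0 := enum_val i; rewrite (enum_val_nth x0 i) (enum_val_nth x0 j).
have h : sorted ltI (enum A) := sorted_enum (mem A).
by apply: (sorted_ltn_nth ltI_trans x0 h); rewrite ?inE -?cardE.
Qed.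

End Listing.

Section Ket.
Variables (R : realType) (N M1 M2 : nat).
Implicit Types (c d : config N) (z : {ffun 'I_M1 -> 'I_N}) (w : {ffun 'I_M2 -> 'I_N}).

Definition basis_state c : state R N := [ffun d : config N => ((d == c)%:R : R[i])].

Definition paint (l : seq 'I_N) (s : color) c : config N :=
  [ffun x => if x \in l then s else c x].

Definition placement_config z w : config N := paint (codom z) blue (paint (codom w) red [ffun=> green]).

Lemma flip_basis_state a s c : c a = green ->
  flip a s green (basis_state c) = basis_state (recolor c a s).
Proof.
move=> ca; apply/ffunP=> d; rewrite !ffunE.
have [das|das] := eqVneq (d a) s.
  congr (_%:R); congr nat_of_bool; apply/eqP/eqP => [<-|->].
    by rewrite recolor_recolor recolor_id.
  by rewrite recolor_recolor recolor_id.
by case: eqP => // e; move: das; rewrite e recolor_at eqxx.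
Qed.

Lemma foldr_flip (l : seq 'I_N) s c : uniq l -> (forall a, a \in l -> c a = green) ->
  foldr (fun a => flip a s green) (basis_state c) l = basis_state (paint l s c).
Proof.
elim: l => [|a l IH] /=.
  by move=> _ _; congr basis_state; apply/ffunP=> x; rewrite ffunE.
move=> /andP[al ul] h; rewrite IH //; last by move=> b bl; rewrite h // in_cons bl orbT.
rewrite flip_basis_state; last by rewrite ffunE (negPf al) h // mem_head.
congr basis_state; apply/ffunP=> x; rewrite !ffunE in_cons; by case: eqP.
Qed.

Lemma uniq_codom k (z : {ffun 'I_k -> 'I_N}) : injective z -> uniq (codom z).
Proof. by move=> zi; rewrite map_inj_uniq ?enum_uniq. Qed.

Lemma placement_state z w : placement z w ->
  foldr (fun a => flip a blue green)
    (foldr (fun a => flip a red green) (all_green R N) (codom w)) (codom z)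
  = basis_state (placement_config z w).
Proof.
case/and3P=> /injectiveP zi /injectiveP wi dzw.
rewrite [all_green R N](_ : _ = basis_state [ffun=> green]) //.
rewrite foldr_flip ?uniq_codom //; last by move=> a _; rewrite ffunE.
rewrite foldr_flip ?uniq_codom // => a az.
by rewrite !ffunE (disjointFr dzw az).
Qed.

Lemma color_set_placement_config_blue z w : color_set (placement_config z w) blue =i codom z.
Proof. by move=> a; rewrite inE !ffunE; case: ifP => //; case: ifP. Qed.

Lemma color_set_placement_config_red z w : placement z w -> color_set (placement_config z w) red =i codom w.
Proof.
case/and3P=> _ _ dzw a; rewrite inE !ffunE; case: ifP => [az|_].
  by rewrite (disjointFr dzw az).
by case: ifP.
Qed.

Lemma card_mem_codom k (A : {set 'I_N}) (z : {ffun 'I_k -> 'I_N}) :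
  injective z -> A =i codom z -> #|A| = k.
Proof. by move=> zi e; rewrite (eq_card e) card_codom // card_ord. Qed.

(** Requires the wave function to depend only on the sets of occupied sites. Each configuration with
    the right counts arises from exactly one pair of increasing listings, so the double sum has at
    most one nonzero term. *)
Lemma ketE (Psi : wavefun R M1 M2) (g : {set 'I_N} -> {set 'I_N} -> R[i]) :
  (forall z w (A B : {set 'I_N}), injective z -> injective w ->
     A =i codom z -> B =i codom w ->
     Psi (fun i => site R (z i)) (fun k => site R (w k)) = g A B) ->
  forall c, ket N Psi c = if (#|color_set c blue| == M1) && (#|color_set c red| == M2)
    then g (color_set c blue) (color_set c red) else 0 :> R[i].
Proof.
move=> hg c; rewrite /ket sum_ffunE.
under eq_bigr => z _ do rewrite sum_ffunE.
case: ifP => [/andP[/eqP cb /eqP cr]|nc]; last first.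
  rewrite big1 // => z iz; rewrite big1 // => w /andP[iw pzw].
  rewrite placement_state // ffunE ffunE; case: eqP => [ce|_]; last by rewrite scaler0.
  move: nc; rewrite ce (card_mem_codom (increasing_inj iz) (@color_set_placement_config_blue z w)).
  by rewrite (card_mem_codom (increasing_inj iw) (color_set_placement_config_red pzw)) !eqxx.
have [z iz ez] := increasing_listing cb; have [w iw ew] := increasing_listing cr.
have pzw : placement z w.
  apply/and3P; split; first exact/injectiveP/increasing_inj.
    exact/injectiveP/increasing_inj.
  apply/pred0P => a /=; rewrite ez ew !inE; case: eqP => //= ->; by [].
have cE : c = placement_config z w.
  apply/ffunP=> a; rewrite !ffunE ez ew !inE.
  by move: (color_cases (c a)) => /or3P[] /eqP->.
rewrite (bigD1 z) //= [X in _ + X]big1 ?addr0 => [|z' /andP[iz' nz]].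
  rewrite (bigD1 w) ?iw //= [X in _ + X]big1 ?addr0 => [|w' /andP[/andP[iw' pw'] nw]].
    rewrite ffunE placement_state // ffunE -cE eqxx /GRing.scale /= mulr1.
    by apply: hg => [||a|a]; rewrite ?ez ?ew //; exact: increasing_inj.
  rewrite ffunE placement_state // ffunE; case: eqP => [ce|_]; last by rewrite scaler0.
  case/eqP: nw; apply: increasing_eq => // a.
  by rewrite -(color_set_placement_config_red pw') -ce ew.
rewrite big1 // => w' /andP[iw' pw'].
rewrite ffunE placement_state // ffunE; case: eqP => [ce|_]; last by rewrite scaler0.
case/eqP: nz; apply: increasing_eq => // a.
by rewrite -(@color_set_placement_config_blue z' w') -ce ez.
Qed.

End Ket.

(** * The wave functions as coefficients of a root polynomial *)

Section WaveFunctionKet.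
Variables (R : realType) (N : nat).
Hypothesis N_gt0 : (0 < N)%N.

Lemma size_prod_XsubC_ord k (x : 'I_k -> R[i]) :
  size (\prod_(i < k) ('X - (x i)%:P)) = k.+1.
Proof. by have := size_prod_XsubC (enum 'I_k) x; rewrite big_enum size_enum_ord. Qed.

(** Fourier inversion on the N-th roots of unity. The polynomial has degree M1 < N, so no two of its
    exponents agree modulo N. *)
Lemma Psin_coef M1 M2 n (z : 'I_M1 -> R[i]) (w : 'I_M2 -> R[i]) :
  (n < N)%N -> (M1 < N)%N ->
  Psin N n z w = (\prod_(i < M1) ('X - (z i)%:P))`_n * Psi0 z w.
Proof.
move=> nN MN; rewrite /Psin; congr (_ * _).
set P := \prod_(i < M1) _.
have sP : (size P <= N)%N by rewrite /P size_prod_XsubC_ord.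
have hP x : \prod_(i < M1) (x - z i) = P.[x].
  by rewrite horner_prod; apply: eq_bigr => i _; rewrite hornerXsubC.
set om := eta R N 1; have prim := eta_prim R N_gt0; rewrite -/om in prim.
rewrite big_add1 /= big_mkord.
rewrite (eq_bigr (fun a : 'I_N => (pt om a ^+ n)^-1 * P.[pt om a])); last first.
  by move=> a _; rewrite hP conj_eta exprVn -/(site R a) siteE.
rewrite (eq_bigr (fun a : 'I_N => \sum_(i < N) P`_i * (pt om a ^+ i / pt om a ^+ n))); last first.
  move=> a _; rewrite (horner_coef_wide _ sP) mulr_sumr; apply: eq_bigr => i _.
  by rewrite mulrC mulrA.
have N0 : N%:R != 0 :> R[i] by rewrite pnatr_eq0 -lt0n.
have nz (a : 'I_N) : pt om a != 0 := pt_neq0 prim a.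
rewrite exchange_big (bigD1 (Ordinal nN)) //= [X in _ + X]big1 ?addr0.
  rewrite -mulr_sumr; have -> : \sum_(a < N) (pt om a ^+ n / pt om a ^+ n) = N%:R.
    transitivity (\sum_(a < N) (pt om a ^+ 0)); last by rewrite sumr_const card_ord.
    by apply: eq_bigr => a _; rewrite divff // expf_neq0.
  by rewrite mulrCA mulVf ?mulr1.
move=> i ni; rewrite -mulr_sumr; apply/eqP; rewrite mulf_eq0; apply/orP; right; apply/eqP.
have {}ni : nat_of_ord i != n by apply: contra ni => /eqP e; apply/eqP/val_inj.
have [lt|ge] := ltnP n i.
  rewrite -[RHS](@sum_pt _ _ _ prim (i - n)); last by have := ltn_ord i; lia.
  by apply: eq_bigr => a _; rewrite expfB.
(* For i < n the exponent i - n is replaced by its representative N - (n - i) modulo N. *)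
rewrite -[RHS](@sum_pt _ _ _ prim (N - (n - i))); last by have := ltn_ord i; lia.
apply: eq_bigr => a _; apply: (mulIf (expf_neq0 n (nz a))).
have e : (N - (n - i) + n = N + i)%N by lia.
rewrite /= divfK; last exact: expf_neq0 (nz a).
by rewrite -exprD e exprD pt_exprN ?mul1r.
Qed.

Lemma Psin_vanish M1 M2 n (z : 'I_M1 -> R[i]) (w : 'I_M2 -> R[i]) :
  (M1 < n)%N -> (n < N)%N -> Psin N n z w = 0.
Proof.
move=> Mn nN; rewrite Psin_coef ?(ltn_trans Mn) // nth_default ?mul0r //.
by rewrite size_prod_XsubC_ord.
Qed.

(** Relates products over i < j of squares to products over ordered pairs; a global sign of the
    state. *)
Definition pair_sign k : R[i] := \prod_(i < k) \prod_(j < k | (i < j)%N) (-1).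

Lemma pair_sign_neq0 k : pair_sign k != 0.
Proof. by apply/prodf_neq0 => i _; apply/prodf_neq0 => j _; rewrite oppr_eq0 oner_eq0. Qed.

Lemma prod_lt_sqr k (x : 'I_k -> R[i]) :
  \prod_(i < k) \prod_(j < k | (i < j)%N) (x i - x j) ^+ 2 =
  pair_sign k * \prod_(i < k) \prod_(j < k | j != i) (x i - x j).
Proof.
have -> : \prod_(i < k) \prod_(j < k | j != i) (x i - x j) =
   \prod_(i < k) \prod_(j < k | (i < j)%N) (- (x i - x j) ^+ 2).
  transitivity ((\prod_(i < k) \prod_(j < k | (i < j)%N) (x i - x j)) *
     (\prod_(i < k) \prod_(j < k | (j < i)%N) (x i - x j))).
    rewrite -big_split; apply: eq_bigr => i _ /=.
    rewrite (bigID (fun j : 'I_k => (i < j)%N)) /=; congr (_ * _); apply: eq_bigl => j.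
      by rewrite -(inj_eq val_inj) neq_ltn; case: ltngtP.
    by rewrite -(inj_eq val_inj) neq_ltn; case: ltngtP.
  rewrite [X in _ * X](exchange_big_dep predT) //= -big_split; apply: eq_bigr => i _ /=.
  by rewrite -big_split; apply: eq_bigr => j _ /=; ring.
rewrite /pair_sign -big_split; apply: eq_bigr => i _ /=.
by rewrite -big_split; apply: eq_bigr => j _ /=; ring.
Qed.

Lemma Psin_amplitude M1 M2 n (z : {ffun 'I_M1 -> 'I_N}) (w : {ffun 'I_M2 -> 'I_N}) (A B : {set 'I_N}) :
  (n < N)%N -> (M1 < N)%N ->
  injective z -> injective w -> A =i codom z -> B =i codom w ->
  Psin N n (fun i => site R (z i)) (fun k => site R (w k)) =
  pair_sign M1 * pair_sign M2 * amplitude (eta R N 1) n A B.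
Proof.
move=> nN MN zi wi Az Bw; rewrite Psin_coef //.
have re k (y : {ffun 'I_k -> 'I_N}) (C : {set 'I_N}) (T : comNzRingType) (f : 'I_N -> T) (P : pred 'I_N) :
    injective y -> C =i codom y -> \prod_(i < k | P (y i)) f (y i) = \prod_(a in C | P a) f a.
  move=> yi Cy; have -> : C = y @: 'I_k.
    apply/setP=> a; rewrite Cy; apply/codomP/imsetP => [[i ->]|[i _ ->]]; by exists i.
  by rewrite big_imset_cond //=; move=> i j _ _; exact: yi.
have re1 k (y : {ffun 'I_k -> 'I_N}) (C : {set 'I_N}) (T : comNzRingType) (f : 'I_N -> T) :
    injective y -> C =i codom y -> \prod_(i < k) f (y i) = \prod_(a in C) f a.
  by move=> yi Cy; rewrite (re k y C T f predT) //; apply: eq_bigl => a; rewrite andbT.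
have rv k (y : {ffun 'I_k -> 'I_N}) (C : {set 'I_N}) : injective y -> C =i codom y ->
    \prod_(i < k) \prod_(j < k | (i < j)%N) (site R (y i) - site R (y j)) ^+ 2
    = pair_sign k * vand2 (eta R N 1) C.
  move=> yi Cy; rewrite (prod_lt_sqr (fun i => site R (y i))); congr (_ * _).
  rewrite /vand2 -(re1 _ y C _ _ yi Cy); apply: eq_bigr => i _.
  rewrite -(re _ y C _ _ _ yi Cy); apply: eq_big => [j|j _]; first by rewrite (inj_eq yi).
  by rewrite !siteE.
have hphi : \prod_(i < M1) ('X - (site R (z i))%:P) = root_poly (eta R N 1) A.
  by rewrite /root_poly -(re1 _ z A _ _ zi Az); apply: eq_bigr => i _; rewrite siteE.
have hcross : \prod_(i < M1) \prod_(k < M2) (site R (z i) - site R (w k)) =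
    cross (eta R N 1) A B.
  rewrite /cross -(re1 _ z A _ _ zi Az); apply: eq_bigr => i _.
  by rewrite -(re1 _ w B _ _ wi Bw); apply: eq_bigr => k _; rewrite !siteE.
have hprod k (y : {ffun 'I_k -> 'I_N}) (C : {set 'I_N}) : injective y -> C =i codom y ->
    \prod_(i < k) site R (y i) = \prod_(a in C) pt (eta R N 1) a.
  by move=> yi Cy; rewrite -(re1 _ y C _ _ yi Cy); apply: eq_bigr => i _; rewrite siteE.
rewrite /amplitude /root_coef hphi /Psi0 (rv _ z A zi Az) (rv _ w B wi Bw) hcross.
by rewrite (hprod _ z A zi Az) (hprod _ w B wi Bw) /ground_amp; ring.
Qed.

End WaveFunctionKet.

(** * The states are nonzero *)

Section Nonvanishing.
Variables (F : numFieldType) (N : nat) (om : F).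
Hypothesis om_prim : N.-primitive_root om.

Lemma ground_amp_neq0 (B R : {set 'I_N}) : [disjoint B & R] -> ground_amp om B R != 0.
Proof.
move=> dBR; have v2 (A : {set 'I_N}) : vand2 om A != 0.
  apply/prodf_neq0 => a _; apply/prodf_neq0 => b /andP[_ ba].
  by rewrite subr_eq0 (inj_eq (pt_inj om_prim)) eq_sym.
have pz (A : {set 'I_N}) : \prod_(a in A) pt om a != 0.
  by apply/prodf_neq0 => a _; exact: pt_neq0.
rewrite /ground_amp !mulf_neq0 //; apply/prodf_neq0 => a aB; apply/prodf_neq0 => k kR.
rewrite subr_eq0 (inj_eq (pt_inj om_prim)); apply: contraTneq kR => <-.
by rewrite (disjointFr dBR aB).
Qed.

(** Induction on the size. For n = k the coefficient is the leading 1 of a monic polynomial.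
    Otherwise add a site to a smaller good set: the coefficients for two different added sites
    differ by (z_a - z_b) times a nonzero coefficient, so they cannot both vanish. *)
Lemma exists_root_coef_neq0 n k : (n <= k)%N -> (k < N)%N ->
  exists2 B : {set 'I_N}, #|B| = k & root_coef om n B != 0.
Proof.
elim: k => [|k IH] nk kN.
  exists set0; first exact: cards0.
  by move: nk; rewrite leqn0 => /eqP->; rewrite /root_coef /root_poly big_set0 coefC oner_eq0.
move: nk; rewrite leq_eqVlt => /predU1P[->|nk].
  have /card_geqP[s [us ss _]] : (k.+1 <= #|'I_N|)%N by rewrite card_ord ltnW.
  have cB : #|[set x in s]| = k.+1 by rewrite cardsE; move/card_uniqP: us => ->.
  exists [set x in s] => //.
  rewrite /root_coef -cB; have sz := size_root_poly om [set x in s].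
  have -> : #|[set x in s]| = (size (root_poly om [set x in s])).-1 by rewrite sz.
  by rewrite -lead_coefE lead_coef_eq0 -size_poly_eq0 sz.
have [B cB pB] := IH nk (ltnW kN).
have /card_geqP[s [us ss sB]] : (2 <= #|~: B|)%N.
  by have := cardsC B; rewrite card_ord cB; lia.
case: s us ss sB => [|a [|b [|? ?]]] //= /andP[]; rewrite mem_seq1 => ab _ _ sB.
have aB : a \notin B by rewrite -in_setC sB // mem_head.
have bB : b \notin B by rewrite -in_setC sB // in_cons mem_head orbT.
have [pa|pa] := eqVneq (root_coef om n (a |: B)) 0; last first.
  by exists (a |: B); rewrite // cardsU1 aB cB.
exists (b |: B); first by rewrite cardsU1 bB cB.
apply/eqP => pb; move: pa; rewrite -pb !root_coef_setU1 // => /addrI/oppr_inj/mulIf h.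
by case/eqP: ab; apply: (pt_inj om_prim); apply: h.
Qed.

End Nonvanishing.

(** * Assembling the eigenstate, momentum and spin statements *)

Section Final.
Variables (R : realType) (N m n : nat).
Hypothesis Nm : N = (3 * m + 2)%N.
Hypothesis nm : (n <= m)%N.

Let N_gt0 : (0 < N)%N. Proof. by rewrite Nm addn2. Qed.
Let nN : (n < N)%N. Proof. by rewrite Nm; lia. Qed.
Let mN : (m < N)%N. Proof. by rewrite Nm; lia. Qed.
Let NR : N%:R = 3 * m%:R + 2 :> R. Proof. by rewrite Nm natrD natrM. Qed.
Let N0 : N%:R != 0 :> R. Proof. by rewrite pnatr_eq0 -lt0n. Qed.

Notation om := (eta R N 1).
Let prim : N.-primitive_root om := eta_prim R N_gt0.
Notation psi := (@ket R N m m.+1 (@Psin R N m m.+1 n)).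
Let sgn : R[i] := pair_sign R m * pair_sign R m.+1.

Let psiE c : psi c = sgn * wave om m n c :> R[i].
Proof.
rewrite (@ketE R N m m.+1 _ (fun A B => sgn * amplitude om n A B)).
  by rewrite /wave /valid; case: ifP; rewrite ?mulr0.
by move=> z w A B zi wi Az Bw; apply: Psin_amplitude.
Qed.

Let sgn0 : sgn != 0.
Proof. by rewrite mulf_neq0 ?pair_sign_neq0. Qed.

Lemma ket_neq0 : psi != 0.
Proof.
have [B cB pB] := exists_root_coef_neq0 prim nm mN.
have /card_geqP[s [us ss sB]] : (m.+1 <= #|~: B|)%N.
  by have := cardsC B; rewrite card_ord cB; lia.
pose c : config N := [ffun a => if a \in B then blue else if a \in s then red else green].
have bc : color_set c blue = B.
  by apply/setP=> a; rewrite inE ffunE; case: ifP => //; case: ifP.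
have rc : color_set c red =i s.
  move=> a; rewrite inE ffunE; case: ifP => [aB|_]; last by case: ifP.
  by apply/esym/negP => /sB; rewrite in_setC aB.
have cR : #|color_set c red| = m.+1 by rewrite (eq_card rc); move/card_uniqP: us => ->.
apply/eqP => /ffunP /(_ c); rewrite psiE ffunE => /eqP.
rewrite mulf_eq0 (negPf sgn0) /wave /valid bc cR cB !eqxx /= /amplitude mulf_eq0 (negPf pB) /=.
by rewrite (negPf (ground_amp_neq0 prim _)) // -bc disjoint_color_set.
Qed.

Lemma ket_weight s : total_flip s s psi =
  (if s == blue then m else m.+1)%:R *: psi.
Proof.
apply/ffunP=> c; rewrite total_flipE ffunE /GRing.scale /=.
transitivity (#|color_set c s|%:R * psi c : R[i]).
  rewrite mulr_natl -sumr_const [RHS]big_mkcond; apply: eq_bigr => a _; rewrite inE.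
  by case: eqP => [ca|_]; rewrite ?mul0r // mul1r recolor_id.
rewrite psiE /wave /valid; case: ifP => [/andP[/eqP cb /eqP cr]|_]; last by rewrite !mulr0.
congr (_%:R * _); have := card_color_set c; rewrite cb cr => h.
have /or3P[] := color_cases s => /eqP->; rewrite ?cb ?cr //=.
by apply: (@addnI (m + m.+1)); rewrite h [LHS]Nm; lia.
Qed.

Let color_set_recolor (c : config N) (a : 'I_N) s t : color_set (recolor c a t) s =
  if t == s then a |: color_set c s else color_set c s :\ a.
Proof.
by apply/setP=> x; case: ifP => ts; rewrite !inE ffunE; case: (eqVneq x a); rewrite ?ts.
Qed.

(** Turning a green site u red gives a multiple of [particle_poly] at u, which has degree at most
    3m+1 = N-1 and no constant term. It vanishes at blue and red sites, so the green sum is a full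
    lattice sum, equal to 0. *)
Lemma ket_green_red : total_flip green red psi = 0.
Proof.
apply/ffunP=> c; rewrite total_flipE ffunE.
set B := color_set c blue; set C := color_set c red.
have gE (a : 'I_N) : c a = green -> color_set (recolor c a red) blue = B /\
    color_set (recolor c a red) red = a |: C /\ a \notin C.
  move=> ca; rewrite !color_set_recolor /=.
  have aC : a \notin C by rewrite inE ca.
  by split=> //; apply/setDidPl; rewrite disjoint_sym disjoints1 inE ca.
have [cc|ncc] := boolP ((#|B| == m) && (#|C| == m)); last first.
  rewrite big1 // => a _; case: eqP => [/gE[b1 [b2 b3]]|_]; last by rewrite mul0r.
  by rewrite psiE /wave /valid b1 b2 cardsU1 b3 eqSS (negPf ncc) !mulr0.
have /andP[/eqP cB /eqP cC] := cc.
have sz : (size (particle_poly om C B) <= N)%N.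
  by apply: leq_trans (size_particle_poly prim C B) _; rewrite cB cC [X in (_ <= X)%N]Nm; lia.
have z0 : (particle_poly om C B)`_0 = 0 by rewrite /particle_poly -mulrA coefXM.
have s1 := sum_horner_pt prim sz z0.
pose k := sgn * root_coef om n B * (-1) ^+ (m * m.+1) * (-1) ^+ m * ground_amp om C B.
suff key : \sum_(u < N) (c u == green)%:R * (psi (recolor c u red) : R[i]) =
    k * \sum_(u < N) (particle_poly om C B).[pt om u] by rewrite [LHS]key s1 mulr0.
rewrite mulr_sumr; apply: eq_bigr => u _; case: eqP => [cu|/eqP ncu].
  have [b1 [b2 b3]] := gE _ cu.
  rewrite mul1r psiE /wave /valid b1 b2 cardsU1 b3 cC cB !eqxx /= /amplitude.
  by rewrite ground_ampC cardsU1 b3 cC cB ground_amp_setU1 // cC /k mulnC; ring.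
rewrite mul0r particle_poly_eq0 ?mulr0 //.
by move: ncu; rewrite !inE; move: (color_cases (c u)) => /or3P[] /eqP->.
Qed.

(** As for green-red, with the affine factor [f] from [root_coef]; starting from m-1 blue sites, the
    degree is again at most N-1. *)
Lemma ket_green_blue : total_flip green blue psi = 0.
Proof.
apply/ffunP=> c; rewrite total_flipE ffunE.
set B := color_set c blue; set C := color_set c red.
have gE (a : 'I_N) : c a = green -> color_set (recolor c a blue) blue = a |: B /\
    color_set (recolor c a blue) red = C /\ a \notin B.
  move=> ca; rewrite !color_set_recolor /=.
  have aC : a \notin B by rewrite inE ca.
  by split=> //; split=> //; apply/setDidPl; rewrite disjoint_sym disjoints1 inE ca.
have [cc|ncc] := boolP ((#|B|.+1 == m) && (#|C| == m.+1)); last first.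
  rewrite big1 // => a _; case: eqP => [/gE[b1 [b2 b3]]|_]; last by rewrite mul0r.
  by rewrite psiE /wave /valid b1 b2 cardsU1 b3 add1n (negPf ncc) !mulr0.
have /andP[/eqP cB /eqP cC] := cc.
pose f : {poly R[i]} := (('X * root_poly om B)`_n)%:P - (root_poly om B)`_n *: 'X.
have sf : (size f <= 2)%N.
  apply: leq_trans (size_polyD _ _) _; rewrite geq_max size_polyN.
  apply/andP; split; first exact: leq_trans (size_polyC_leq1 _) _.
  by apply: leq_trans (size_scale_leq _ _) _; rewrite size_polyX.
have z0 : (particle_poly om B C * f)`_0 = 0 by rewrite /particle_poly -!mulrA coefXM.
have sz : (size (particle_poly om B C * f)%R <= N)%N.
  apply: leq_trans (size_polyMleq _ _) _; have := size_particle_poly prim B C.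
  (* The count 2(m-1) + (m+1) + 2, plus one for the affine factor, is exactly N. *)
  move: (size (particle_poly om B C)) (size f) sf => x y; rewrite cC -cB [X in _ -> (_ <= X)%N]Nm -cB; lia.
have s1 := sum_horner_pt prim sz z0.
have fE x : f.[x] = ('X * root_poly om B)`_n - x * (root_poly om B)`_n.
  by rewrite /f hornerD hornerN hornerZ hornerX hornerC [x * _]mulrC.
pose k := sgn * (-1) ^+ #|B| * ground_amp om B C.
suff key : \sum_(u < N) (c u == green)%:R * (psi (recolor c u blue) : R[i]) =
    k * \sum_(u < N) (particle_poly om B C * f).[pt om u] by rewrite [LHS]key s1 mulr0.
rewrite mulr_sumr; apply: eq_bigr => u _; rewrite hornerM fE.
case: eqP => [cu|/eqP ncu].
  have [b1 [b2 b3]] := gE _ cu.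
  rewrite mul1r psiE /wave /valid b1 b2 cardsU1 b3 add1n cC cB !eqxx /= /amplitude.
  by rewrite root_coef_setU1 // ground_amp_setU1 // /k; ring.
rewrite mul0r particle_poly_eq0 ?mul0r ?mulr0 //.
by move: ncu; rewrite !inE; move: (color_cases (c u)) => /or3P[] /eqP->.
Qed.

Lemma ket_eigen : hamiltonian psi = (energy R N m n)%:C *: psi.
Proof.
apply/ffunP=> c; rewrite hamiltonianE // ffunE [in RHS]/GRing.scale /=.
have -> : \sum_a \sum_b coupling (site R a) (site R b) * psi (exchange c a b) =
    sgn * \sum_a \sum_b coupling (pt om a) (pt om b) * wave om m n (exchange c a b) :> R[i].
  rewrite mulr_sumr; apply: eq_bigr => a _; rewrite mulr_sumr; apply: eq_bigr => b _.
  by rewrite !siteE // psiE mulrCA.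
set E := exchange_eigenvalue R[i] N m n; set S := \sum_a _.
have hS : S / 2 = E * wave om m n c := wave_exchange prim n Nm c.
clearbody S; rewrite -[sgn * S / 2]mulrA hS psiE.
(* The constant from 1/27 cancels the first term of the exchange eigenvalue, leaving a real
   number. *)
have e : (2 * pi ^+ 2 / N%:R ^+ 2)%:C * (E - N%:R * coupling_total R[i] N / 6) = (energy R N m n)%:C.
  have -> : E - N%:R * coupling_total R[i] N / 6 =
     (- (N%:R ^+ 3 + N%:R + 2) / 36 + 3 / 2 * (m%:R - n%:R) * n%:R)%:C.
    rewrite /E /exchange_eigenvalue !(rmorphD, rmorphM, rmorphN, fmorphV, rmorphXn, rmorph_nat) /=.
    by ring.
  rewrite -rmorphM /=; congr (_%:C); rewrite /energy; field.
  by rewrite N0.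
by rewrite -e; ring.
Qed.

Lemma energyE : energy R N m n
  = energy0 R N + 2 / 9 * (pi ^+ 2 / N%:R ^+ 2) + dispersion (momentum R N n).
Proof.
rewrite /energy /energy0 /dispersion /momentum NR; field.
by rewrite -NR N0.
Qed.

(** Homogeneity of degree k - j, with q^j moved to the left to avoid subtracting exponents. *)
Lemma coef_prod_scale k (x : 'I_k -> R[i]) (q : R[i]) j :
  q ^+ j * (\prod_(i < k) ('X - (q * x i)%:P))`_j =
  q ^+ k * (\prod_(i < k) ('X - (x i)%:P))`_j.
Proof.
elim: k x j => [|k IH] x j.
  by rewrite !big_ord0 !coef1; case: j => [|j]; rewrite ?mulr0.
rewrite !big_ord_recl !mulrBl !coefB !coefXM !coefCM.
have h := IH (fun i => x (lift ord0 i)); case: j => [|j] /=.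
  by rewrite !sub0r !mulrN; congr (- _); rewrite mulrCA h exprS; ring.
rewrite !mulrBr; congr (_ - _); first by rewrite exprS -mulrA h mulrA -exprS.
by rewrite mulrCA h exprS; ring.
Qed.

Lemma Psi0_scale M1 M2 (z : 'I_M1 -> R[i]) (w : 'I_M2 -> R[i]) (q : R[i]) :
  Psi0 (fun i => q * z i) (fun k => q * w k) =
  q ^+ (M1 * M1.-1 + M2 * M2.-1 + M1 * M2 + M1 + M2) * Psi0 z w.
Proof.
have pc k (x : 'I_k -> R[i]) e : \prod_(i < k) (q ^+ e * x i) = q ^+ (k * e) * \prod_(i < k) x i.
  by rewrite big_split prodr_const card_ord mulnC exprM.
have sq k (x : 'I_k -> R[i]) :
    \prod_(i < k) \prod_(j < k | (i < j)%N) (q * x i - q * x j) ^+ 2 =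
    q ^+ (k * k.-1) * \prod_(i < k) \prod_(j < k | (i < j)%N) (x i - x j) ^+ 2.
  rewrite (prod_lt_sqr (fun i => q * x i)) prod_lt_sqr mulrCA -pc; congr (_ * _).
  apply: eq_bigr => i _.
  have -> : q ^+ k.-1 = \prod_(j < k | j != i) q.
    have -> : k.-1 = #|predC1 i| by rewrite cardC1 card_ord.
    by rewrite -prodr_const.
  by rewrite -big_split; apply: eq_bigr => j _ /=; rewrite mulrBr.
rewrite /Psi0 !sq.
have -> : \prod_(i < M1) \prod_(k < M2) (q * z i - q * w k) =
    q ^+ (M1 * M2) * \prod_(i < M1) \prod_(k < M2) (z i - w k).
  rewrite -pc; apply: eq_bigr => i _; rewrite -[M2 in q ^+ M2]muln1 -pc.
  by apply: eq_bigr => k _; rewrite expr1 mulrBr.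
rewrite !big_split /= !prodr_const !card_ord !exprD; ring.
Qed.

(** The wave function is homogeneous, so the phase is a power of eta_1 given by its degree modulo
    N. *)
Lemma Psin_momentum : has_momentum N (@Psin R N m m.+1 n) (momentum R N n).
Proof.
move=> z w _; rewrite !Psin_coef //.
set x := fun i => site R (z i); set y := fun k => site R (w k).
apply: (mulfI (_ : om ^+ n != 0)); first by rewrite expf_neq0 // (om_neq0 prim).
have -> : Psi0 (fun i : 'I_m => om * site R (z i)) (fun k => om * site R (w k)) =
  om ^+ (m * m.-1 + m.+1 * m.+1.-1 + m * m.+1 + m + m.+1) * Psi0 x y.
  by rewrite -Psi0_scale.
rewrite mulrA (coef_prod_scale x).
(* With N = 3m + 2 the momentum is exactly 2 pi (2m + 1 - n)/N. *)
have hc : om ^+ n * (cos (momentum R N n) +i* sin (momentum R N n)) = om ^+ (2 * m + 1).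
  rewrite -!eta_exp // /eta.
  have -> : 2 * pi * (2 * m + 1)%:R / N%:R = 2 * pi * n%:R / N%:R + momentum R N n.
    by rewrite /momentum NR natrD natrM; field; rewrite -NR N0.
  move: (momentum R N n) => p; apply/eqP; rewrite eq_complex /= cosD sinD.
  by apply/andP; split; apply/eqP; ring.
rewrite [RHS]mulrA hc.
rewrite mulrACA -exprD mulrA.
(* The degree of Psi_0 plus m; modulo N it reduces to 2m + 1. *)
have -> : (m + (m * m.-1 + m.+1 * m.+1.-1 + m * m.+1 + m + m.+1) = N * m + (2 * m + 1))%N.
  by rewrite Nm /=; case: (m) => //= k; lia.
rewrite exprD exprM (prim_expr_order prim) expr1n mul1r; exact: esym (mulrA _ _ _).
Qed.

Lemma ket_spin : transforms_as_3bar psi /\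
  [/\ Iminus psi = 0, Vminus psi = 0 & Uminus psi = 0].
Proof.
have wb := ket_weight blue; have wr := ket_weight red; have wg := ket_weight green.
rewrite /= in wb wr wg.
split; first exact: (lowest_transforms ket_green_red ket_green_blue wb wr wg ket_neq0).
split; [| exact: ket_green_blue | exact: ket_green_red].
exact: (lowest_rb ket_green_red ket_green_blue wr wg).
Qed.

End Final.

Theorem mainTheorem1 (R : realType) (M N M1 M2 : nat)
    (hM : (1 <= M)%N)
    (hN : N = (3 * M - 1)%N)
    (hM1 : M1 = ((N - 2) %/ 3)%N)
    (hM2 : M2 = ((N + 1) %/ 3)%N) :
  (forall n : nat, (n <= M1)%N ->
     let psi := @ket R N M1 M2 (@Psin R N M1 M2 n) in
     let p := momentum R N n in
     [/\ eigenstate (@hamiltonian R N) (energy R N M1 n) psi,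
         energy R N M1 n
           = energy0 R N + 2 / 9 * (pi ^+ 2 / N%:R ^+ 2) + dispersion p,
         has_momentum N (@Psin R N M1 M2 n) p,
         transforms_as_3bar psi &
         [/\ Iminus psi = 0, Vminus psi = 0 & Uminus psi = 0]]) /\
  (forall n : nat, (M1 < n)%N -> (n < N)%N ->
     forall (z : 'I_M1 -> R[i]) (w : 'I_M2 -> R[i]),
       Psin N n z w = 0).
Proof.
(* The divisions are exact: M1 = M - 1 and M2 = M. The number of green sites is then also M1 + 1. *)
have Nm : N = (3 * M1 + 2)%N by lia.
have e2 : M2 = M1.+1 by lia.
have N0 : (0 < N)%N by lia.
clear hM hN hM1 hM2; subst M2; split=> [n nM psi p|n Mn nN z w].
  have [h1 h2] := ket_spin R Nm nM.
  split=> //.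
  - by split; [exact: ket_neq0 | exact: ket_eigen].
  - exact: energyE.
  - exact: Psin_momentum.
exact: Psin_vanish.
Qed.
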